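(* Let $\mathbb{P}=\mathbb{P}(V)$ and $\mathbb{P}'=\mathbb{P}(V')$ be projective spaces of dimensions $\geq 3$ associated to vector spaces $V,V'$ over division rings $K$ and $K'$, respectively. Let $X\subseteq\mathbb{P}$ be a subgeometry with enough points and let $\varphi\colon X\to\mathbb{P}'$ be a morphism of geometries such that: 1) the image of $\varphi$ is not contained in a plane of $\mathbb{P}'$; 2) there exist points $x_1,x_2\in X$ such that $X/\!\!/x_i=\mathbb{P}/\!\!/x_i$ for $i=1,2$, and $\varphi(x_1)\neq\varphi(x_2)$. Then $\varphi\colon X\to\mathbb{P}'$ is the restriction of a unique partial projective morphism $\phi\colon\mathbb{P}\dashrightarrow\mathbb{P}'$ (that is, there is a unique partial projective morphism $\phi$ which is defined at every point of $X$ and satisfies $\phi|_X=\varphi$).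
   Context: A geometry is a set $X$ (of points) with a family of subsets, called subspaces, such that: (G1) $\emptyset$, $X$ and every singleton $\{x\}$ are subspaces ($\{x\}$ is written $x$); (G2) any intersection of subspaces is a subspace; (G3) for a subspace $S$ and a point $x\notin S$ there is no subspace $S'$ with $S\subsetneq S'\subsetneq S\vee x$; (G4) for any subset $A\subseteq X$ and $x\in\overline{A}$ there is a finite subset $\{a_1,\dots,a_r\}\subseteq A$ with $x\in\overline{\{a_1,\dots,a_r\}}$. Here $\overline{A}$ is the least subspace containing $A$ and $\vee$ denotes the supremum of subspaces (closure of the union). A set $A$ is independent if $a\notin\overline{A\setminus a}$ for all $a\in A$; a basis of a subspace $S$ is an independent $A\subseteq S$ with $\overline{A}=S$; all bases of $S$ have the same cardinal, and $\dim S$ is this cardinal minus $1$. Lines and planes are the subspaces of dimension $1$ and $2$. Any subset $A$ of a geometry $X$ is a geometry (a subgeometry of $X$) whose subspaces are the sets $S\cap A$ with $S$ a subspace of $X$. A morphism of geometries $\varphi\colon X\to X'$ is a map such that the preimage of every subspace of $X'$ is a subspace of $X$. For a subspace $E$ of a geometry $X$, the quotient $X/\!\!/E$ is the set of classes of $X-E$ under $x_1\equiv x_2\Leftrightarrow x_1\vee E=x_2\vee E$; its subspaces are the images of the subspaces $S$ of $X$ containing $E$; it is a geometry. If $X\subseteq\mathbb{P}$ is a subgeometry and $x\in X$, then $X/\!\!/x$ is identified with a subgeometry of $\mathbb{P}/\!\!/x$ through $[y]\mapsto[y]$; the condition $X/\!\!/x=\mathbb{P}/\!\!/x$ means that this inclusion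 is an equality. A geometry $X$ of dimension $\geq 2$ has enough points when every plane of $X$ has four points, no three of which are collinear (equivalently, the lines of $X/\!\!/x$ have at least three points for all $x\in X$). For a (left) vector space $V$ over a division ring, $\mathbb{P}(V)$ is the set of 1-dimensional vector subspaces of $V$, a geometry whose subspaces are the subsets $\mathbb{P}(W)$ for vector subspaces $W\subseteq V$; $\dim\mathbb{P}(W)=\dim W-1$. A map $\Phi\colon V\to V'$ is semilinear if it is additive and there is a ring morphism $\sigma\colon K\to K'$ (not necessarily surjective) with $\Phi(\lambda v)=\sigma(\lambda)\Phi(v)$ for all $\lambda\in K$, $v\in V$. A semilinear map $\Phi$ induces a partially defined map $\phi\colon\mathbb{P}(V)\dashrightarrow\mathbb{P}(V')$, $\langle v\rangle\mapsto\langle\Phi(v)\rangle$, with domain $\mathbb{P}(V)-\mathbb{P}(\ker\Phi)$; such partial maps are called partial projective morphisms. *)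

(* Defs.v *)
From HB Require Import structures.
From mathcomp Require Import all_boot all_order all_algebra.
From mathcomp Require Import mathcomp_extra boolp classical_sets functions.
From mathcomp Require Import cardinality.

Set Implicit Arguments.
Unset Strict Implicit.
Unset Printing Implicit Defensive.

Import GRing.Theory.

Local Open Scope classical_set_scope.
Local Open Scope card_scope.
Local Open Scope ring_scope.

(* [smallest sub A], the intersection of all members of [sub] containing [A],
   is the closure of [A]; [smallest sub (A `|` B)] is the join of [A] and [B]. *)
Record geometry := Geometry {
  gpoint :> Type;
  is_subspace : set (set gpoint);
  subspace0 : is_subspace set0;
  subspaceT : is_subspace setT;
  subspace1 : forall x, is_subspace [set x];
  subspaceI : forall F : set (set gpoint), F `<=` is_subspace ->
    is_subspace (\bigcap_(S in F) S);
  subspace_cover : forall S x, is_subspace S -> ~ S x ->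
    ~ exists S', [/\ is_subspace S', S `<` S'
                   & S' `<` smallest is_subspace (S `|` [set x])];
  subspace_finitary : forall A x, smallest is_subspace A x ->
    exists F, [/\ finite_set F, F `<=` A & smallest is_subspace F x]
}.

Section Geometry.
Variable G : geometry.
Implicit Types A B S E L : set G.

Definition gclosure A : set G := smallest (@is_subspace G) A.

Definition gjoin A B : set G := gclosure (A `|` B).

Definition independent A : Prop := forall a, A a -> ~ gclosure (A `\ a) a.

Definition is_basis A S : Prop :=
  [/\ A `<=` S, independent A & gclosure A = S].

(* All bases of a subspace have the same cardinality, so it is harmless to
   quantify existentially over the basis.  The dimension is the cardinality of a
   basis minus one; it may be infinite, whence the separate [dim_ge]. *)
Definition has_dim S (n : nat) : Prop :=
  is_subspace S /\ exists2 A, is_basis A S & A #= `I_n.+1.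

Definition dim_ge S (n : nat) : Prop :=
  is_subspace S /\ exists2 A, is_basis A S & `I_n.+1 #<= A.

Definition is_line L : Prop := has_dim L 1.

Definition is_plane S : Prop := has_dim S 2.

Definition collinear (x y z : G) : Prop :=
  exists L, [/\ is_line L, L x, L y & L z].

Definition enough_points : Prop :=
  dim_ge [set: G] 2 /\
  forall S, is_plane S ->
    exists p : 'I_4 -> G, [/\ injective p, (forall i, S (p i))
      & forall i j k, uniq [:: i; j; k] -> ~ collinear (p i) (p j) (p k)].

Definition quotient_class E (y : G) : set G :=
  [set z | ~ E z /\ gjoin [set z] E = gjoin [set y] E].

(* The set of points of the quotient geometry G//E. *)
Definition gquotient E : set (set G) := [set quotient_class E y | y in ~` E].

End Geometry.

Definition is_morphism (G G' : geometry) (f : G -> G') : Prop :=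
  forall S', is_subspace S' -> is_subspace (f @^-1` S').

Section Subgeometry.
Variables (G : geometry) (X : set G).

Definition trace_subspace : set (set X) :=
  [set (@set_val G X) @^-1` S | S in @is_subspace G].

Lemma set_val_inj : injective (@set_val G X).
Proof. exact: val_inj. Qed.

Lemma closure_subspace (A : set G) : is_subspace (gclosure A).
Proof. by apply: subspaceI => S []. Qed.

Lemma trace_subspace0 : trace_subspace set0.
Proof. by exists set0; [exact: subspace0|]. Qed.

Lemma trace_subspaceT : trace_subspace setT.
Proof. by exists setT; [exact: subspaceT|]. Qed.

Lemma trace_subspace1 x : trace_subspace [set x].
Proof.
exists [set set_val x]; first exact: subspace1.
by apply/seteqP; split => y /=; [apply: set_val_inj|move=> ->].
Qed.

Lemma trace_subspaceI (F : set (set X)) : F `<=` trace_subspace ->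
  trace_subspace (\bigcap_(S in F) S).
Proof.
move=> FX.
pose H := [set S | is_subspace S /\ F ((@set_val G X) @^-1` S)].
exists (\bigcap_(S in H) S); first by apply: subspaceI => S [].
apply/seteqP; split=> [x Hx S FS|x Fx S [_ FS]]; last exact: (Fx _ FS).
by have [T sT TS] := FX _ FS; rewrite -TS; apply: Hx; split=> //; rewrite TS.
Qed.

Lemma trace_closure (S : set X) : trace_subspace S ->
  (@set_val G X) @^-1` gclosure (@set_val G X @` S) = S.
Proof.
case=> T sT <-; apply/seteqP; split=> x /=.
  by apply; split=> // _ [y Ty <-].
by move=> Tx; apply: sub_gen_smallest; exists x.
Qed.

Lemma trace_subspace_cover S x : trace_subspace S -> ~ S x ->
  ~ exists S', [/\ trace_subspace S', S `<` S'
                 & S' `<` smallest trace_subspace (S `|` [set x])].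
Proof.
move=> tS Sx [S' [tS' [SS' nS'S] [S'J nJS']]].
have JT : forall T, is_subspace T -> gclosure (@set_val G X @` S) `<=` T ->
    T (set_val x) -> smallest trace_subspace (S `|` [set x]) `<=`
                     (@set_val G X) @^-1` T.
  move=> T sT ST Tx; apply: smallest_sub; first by exists T.
  move=> y [Sy|->//]; apply: ST; apply: sub_gen_smallest; by exists y.
apply: (@subspace_cover G (gclosure (@set_val G X @` S)) (set_val x)).
- exact: closure_subspace.
- by move=> cSx; apply: Sx; rewrite -(trace_closure tS).
exists (gclosure (@set_val G X @` S')); split; first exact: closure_subspace.
- split.
    apply: smallest_sub; first exact: closure_subspace.
    by move=> _ [y Sy <-]; apply: sub_gen_smallest; exists y => //; apply: SS'.
  move=> cSS'; apply: nS'S => y S'y; rewrite -(trace_closure tS).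
  by apply: cSS'; apply: sub_gen_smallest; exists y.
split.
  apply: smallest_sub; first exact: closure_subspace.
  move=> _ [y S'y <-].
  apply: (JT (gjoin (gclosure (@set_val G X @` S)) [set set_val x]) _ _ _ y);
    last exact: S'J.
  - exact: closure_subspace.
  - by move=> z Sz; apply: sub_gen_smallest; left.
  - by apply: sub_gen_smallest; right.
move=> JS'; apply: nJS'; rewrite -(trace_closure tS'); apply: JT.
- exact: closure_subspace.
- by move=> z Sz; apply: JS'; apply: sub_gen_smallest; left.
- by apply: JS'; apply: sub_gen_smallest; right.
Qed.

Lemma trace_subspace_finitary A x : smallest trace_subspace A x ->
  exists F, [/\ finite_set F, F `<=` A & smallest trace_subspace F x].
Proof.
move=> Ax.
have : gclosure (@set_val G X @` A) (set_val x).
  move=> T [sT AT]; apply: (Ax ((@set_val G X) @^-1` T)); split.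
    by exists T.
  by move=> y Ay; apply: AT; exists y.
case/subspace_finitary=> F [finF FA Fx].
exists ((@set_val G X) @^-1` F); split.
- by apply: finite_preimage => // y z _ _; apply: set_val_inj.
- by move=> y /FA[z Az] /set_val_inj <-.
move=> _ [[T sT <-] FT]; apply: Fx; split=> // y Fy.
have [z _ zy] := FA _ Fy.
by rewrite -zy; apply: FT; rewrite /= zy.
Qed.

Definition subgeometry : geometry :=
  Geometry trace_subspace0 trace_subspaceT trace_subspace1 trace_subspaceI
           trace_subspace_cover trace_subspace_finitary.

Definition sub_incl : subgeometry -> G := @set_val G X.

(* The map [y] |-> [y] from X//x to G//x.  A point [c] of X//x is a nonempty set
   of points of X which all have the same class in G//x, so that the union below
   is this common class: see [quotient_incl_class]. *)
Definition quotient_incl (x : subgeometry) (c : set subgeometry) : set G :=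
  \bigcup_(y in c) quotient_class [set sub_incl x] (sub_incl y).

Lemma trace_join (A B : set subgeometry) :
  gjoin A B = sub_incl @^-1` gjoin (sub_incl @` A) (sub_incl @` B).
Proof.
apply/seteqP; split=> z.
  apply; split.
    by exists (gjoin (sub_incl @` A) (sub_incl @` B));
      [exact: closure_subspace|].
  by move=> y [?|?]; apply: sub_gen_smallest; [left|right]; exists y.
move=> Jz _ [[T sT <-] ABT]; apply: Jz; split=> // _ [[y ? <-]|[y ? <-]].
  by apply: ABT; left.
by apply: ABT; right.
Qed.

Lemma quotient_incl_class (x y : subgeometry) : y <> x ->
  quotient_incl x (quotient_class [set x] y) =
  quotient_class [set sub_incl x] (sub_incl y).
Proof.
move=> yx; apply/seteqP; split=> [u [z [zx Jz] [ux Ju]]|u [ux Ju]]; last first.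
  by exists y.
split=> //; rewrite Ju; apply/seteqP; split; apply: smallest_sub;
  try exact: closure_subspace.
  move=> v [->|->]; last by apply: sub_gen_smallest; right.
  have : gjoin [set y] [set x] z.
    by rewrite -Jz; apply: sub_gen_smallest; left.
  by rewrite trace_join !image_set1.
move=> v [->|->]; last by apply: sub_gen_smallest; right.
have : gjoin [set z] [set x] y.
  by rewrite Jz; apply: sub_gen_smallest; left.
by rewrite trace_join !image_set1.
Qed.

(* X//x = G//x, as subsets of the points of G//x. *)
Definition same_quotient (x : subgeometry) : Prop :=
  quotient_incl x @` gquotient [set x] = gquotient [set sub_incl x].

End Subgeometry.

Definition division_ring (K : unitRingType) : Prop :=
  forall a : K, a != 0 -> a \is a GRing.unit.

Section ProjectiveSpace.
Variables (K : unitRingType) (divK : division_ring K) (V : lmodType K).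
Implicit Types (W : set V) (v : V).

Definition vline v : set V := [set a *: v | a in [set: K]].

Definition proj_point : Type :=
  {L : set V | exists2 v, v != 0 & L = vline v}.

Definition vline_point v (v0 : v != 0) : proj_point :=
  exist _ (vline v) (ex_intro2 _ _ v v0 erefl).

Definition vsubspace W : Prop := GRing.submod_closed (mem W).

Definition proj_of W : set proj_point := [set p | sval p `<=` W].

Definition proj_subspace : set (set proj_point) :=
  [set proj_of W | W in vsubspace].

Lemma vsubspaceP W : vsubspace W <->
  W 0 /\ forall a u v, W u -> W v -> W (a *: u + v).
Proof.
split=> -[W0 Wl]; split.
- by move: W0; rewrite inE.
- by move=> a u v Wu Wv; have := Wl a u v; rewrite !inE; apply.
- by rewrite inE.
- by move=> a u v; rewrite !inE; apply: Wl.
Qed.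

Lemma vsubspaceZ W a v : vsubspace W -> W v -> W (a *: v).
Proof. by case/vsubspaceP=> W0 Wl Wv; rewrite -[_ *: _]addr0; apply: Wl. Qed.

Lemma vsubspaceZK W a v : vsubspace W -> a != 0 -> W (a *: v) -> W v.
Proof.
move=> sW a0 /(vsubspaceZ a^-1 sW).
by rewrite scalerA mulVr ?scale1r//; apply: divK.
Qed.

Lemma vline_id v : vline v v.
Proof. by exists 1; rewrite // scale1r. Qed.

Lemma vsubspace_line v : vsubspace (vline v).
Proof.
apply/vsubspaceP; split; first by exists 0; rewrite // scale0r.
move=> a _ _ [b _ <-] [c _ <-]; exists (a * b + c) => //.
by rewrite scalerDl scalerA.
Qed.

Lemma vline_sub W v : vsubspace W -> (vline v `<=` W) <-> W v.
Proof.
move=> sW; split=> [|Wv _ [a _ <-]]; last exact: vsubspaceZ.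
by apply; apply: vline_id.
Qed.

Lemma proj_pointP (p : proj_point) : exists v (v0 : v != 0), p = vline_point v0.
Proof.
case: p => L Lv; have [v v0 LE] := Lv; exists v, v0.
by apply: eq_exist.
Qed.

Lemma proj_ofE W v (v0 : v != 0) : vsubspace W ->
  proj_of W (vline_point v0) <-> W v.
Proof. exact: vline_sub. Qed.

Lemma proj_of_sub W W' : vsubspace W -> vsubspace W' ->
  proj_of W `<=` proj_of W' -> W `<=` W'.
Proof.
move=> sW sW' WW' v Wv; have [->|v0] := eqVneq v 0.
  by case/vsubspaceP: sW'.
by apply/(proj_ofE v0 sW'); apply: WW'; apply/proj_ofE.
Qed.

Lemma proj_subspace0 : proj_subspace set0.
Proof.
exists [set 0].
  by apply/vsubspaceP; split=> //= a u v -> ->; rewrite scaler0 addr0.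
apply/seteqP; split=> // p; have [v [v0 ->]] := proj_pointP p.
by move=> /(_ v (vline_id v))/eqP; apply/negP.
Qed.

Lemma proj_subspaceT : proj_subspace setT.
Proof. by exists setT; [exact/vsubspaceP|apply/seteqP; split]. Qed.

Lemma proj_subspace1 p : proj_subspace [set p].
Proof.
have [v [v0 ->]] := proj_pointP p; exists (vline v).
  exact: vsubspace_line.
apply/seteqP; split=> [q|_ -> //].
have [w [w0 ->]] := proj_pointP q.
case/(_ w (vline_id w)) => a _ avw.
apply: eq_exist; apply/seteqP; split; apply/vline_sub;
  try exact: vsubspace_line.
  by exists a.
apply: (@vsubspaceZK _ a); first exact: vsubspace_line.
  by apply: contra_neq w0 => a0; rewrite -avw a0 scale0r.
by rewrite avw; apply: vline_id.
Qed.

Lemma proj_subspaceI (F : set (set proj_point)) : F `<=` proj_subspace ->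
  proj_subspace (\bigcap_(S in F) S).
Proof.
move=> FP; pose H := [set W | vsubspace W /\ F (proj_of W)].
exists (\bigcap_(W in H) W).
  apply/vsubspaceP; split=> [W [/vsubspaceP[]]//|a u v Hu Hv W HW].
  by case: (HW) => /vsubspaceP[_ Wl] _; apply: Wl; [apply: Hu|apply: Hv].
apply/seteqP; split=> [p Hp S FS|p Fp v pv W [_ FW]]; last exact: (Fp _ FW).
have [W sW WS] := FP _ FS; rewrite -WS => v pv; apply: Hp => //; split=> //.
by rewrite WS.
Qed.

Lemma proj_subspace_cover S x : proj_subspace S -> ~ S x ->
  ~ exists S', [/\ proj_subspace S', S `<` S'
                 & S' `<` smallest proj_subspace (S `|` [set x])].
Proof.
move=> [W sW <-]; have [v [v0 ->]] := proj_pointP x => nWv.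
case=> _ [[W' sW' <-] [WW' nW'W] [W'J nJW']]; apply: nJW'.
have {}WW' := proj_of_sub sW sW' WW'.
suff W'v : W' v.
  apply: smallest_sub; first by exists W'.
  by move=> p [Wp|->]; [move=> u /Wp/WW'|apply/proj_ofE].
pose U := [set u | exists2 w, W w & exists a, u = a *: v + w].
have sU : vsubspace U.
  have /vsubspaceP[W0 Wl] := sW.
  apply/vsubspaceP; split; first by exists 0 => //; exists 0;
    rewrite scale0r addr0.
  move=> a _ _ [w Ww [b ->]] [w' Ww' [c ->]].
  exists (a *: w + w'); first exact: Wl.
  by exists (a * b + c); rewrite scalerDr scalerDl scalerA addrACA.
have W'U : W' `<=` U.
  apply: proj_of_sub => // p /W'J; apply; split; first by exists U.
  move=> q [Wq u /Wq Wu|->]; first by exists u => //; exists 0;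
    rewrite scale0r add0r.
  apply/proj_ofE => //; exists 0; first by case/vsubspaceP: sW.
  by exists 1; rewrite scale1r addr0.
apply: contrapT => nW'v; apply: nW'W => p W'p u pu.
have [w Ww [a uE]] := W'U _ (W'p _ pu).
have [a0|a0] := eqVneq a 0; first by rewrite uE a0 scale0r add0r.
case: nW'v; apply: (vsubspaceZK sW' a0).
have -> : a *: v = (-1) *: w + u by rewrite uE scaleN1r addrCA addNr addr0.
by case/vsubspaceP: sW' => _; apply; [exact: WW'|exact: W'p].
Qed.

Lemma proj_subspace_finitary A x : smallest proj_subspace A x ->
  exists F, [/\ finite_set F, F `<=` A & smallest proj_subspace F x].
Proof.
move=> Ax.
pose U := [set u | exists F, [/\ finite_set F, F `<=` A &
  forall W, vsubspace W -> F `<=` proj_of W -> W u]].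
have sU : vsubspace U.
  apply/vsubspaceP; split.
    by exists set0; split=> // W /vsubspaceP[].
  move=> a u v [F [fF FA Fu]] [F' [fF' FA' Fv]].
  exists (F `|` F'); split; first by rewrite finite_setU.
    by move=> p [/FA|/FA'].
  move=> W sW FW; case/vsubspaceP: (sW) => _; apply.
    by apply: Fu => // p Fp; apply: FW; left.
  by apply: Fv => // p Fp; apply: FW; right.
have : proj_of U x.
  apply: Ax; split; first by exists U.
  move=> p Ap u pu; exists [set p]; split=> // [_ -> //|W _ pW].
  exact: (pW p).
have [v [v0 ->]] := proj_pointP x.
move=> /(proj_ofE v0 sU) [F [fF FA Fv]]; exists F; split=> //.
by move=> _ [[W sW <-] FW]; apply/proj_ofE => //; apply: Fv.
Qed.

Definition projective_space : geometry :=
  Geometry proj_subspace0 proj_subspaceT proj_subspace1 proj_subspaceI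
           proj_subspace_cover proj_subspace_finitary.

End ProjectiveSpace.

Definition semilinear (K K' : unitRingType) (V : lmodType K) (V' : lmodType K')
    (Phi : V -> V') : Prop :=
  (forall u v, Phi (u + v) = Phi u + Phi v) /\
  exists sigma : {rmorphism K -> K'},
    forall (a : K) (v : V), Phi (a *: v) = sigma a *: Phi v.

(* Partial maps are functions to an option type, [None] meaning undefined. *)
Definition partial_projective_morphism (K K' : unitRingType)
    (divK : division_ring K) (divK' : division_ring K')
    (V : lmodType K) (V' : lmodType K')
    (phi : projective_space divK V -> option (projective_space divK' V'))
    : Prop :=
  exists2 Phi : V -> V', semilinear Phi &
    forall (v : V) (v0 : v != 0),
      (Phi v = 0 -> phi (vline_point v0) = None) /\
      forall w0 : Phi v != 0, phi (vline_point v0) = Some (vline_point w0).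

(* Main.v *)
Require Import Defs.
From HB Require Import structures.
From mathcomp Require Import all_boot all_order all_algebra.
From mathcomp Require Import mathcomp_extra boolp classical_sets functions.
From mathcomp Require Import cardinality.

Set Implicit Arguments.
Unset Strict Implicit.
Unset Printing Implicit Defensive.

Import GRing.Theory.

Local Open Scope classical_set_scope.
Local Open Scope ring_scope.

(** Write points as lines of vectors.  On the cone of the vectors that span a
    point of [X], the morphism lifts to a map [h] into [V'] which sends vectors
    dependent on at most three others to vectors dependent on their images.

    Let [e] span a point [x] with [X//x = P//x].  Every line through [x] carries
    a second point of [X], so that [h], read modulo [<h e>], extends to all of
    [V] and becomes a map [g] into [V' / <h e>] which respects collinearity and
    whose image has rank at least three, because the image of the morphism is
    not contained in a plane.  The fundamental theorem of projective geometry
    for partially defined, possibly not injective maps ([fundamental_additive],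
    [semilinear_of_lines], after Faure and Froelicher) turns [g] into a
    semilinear map.

    Doing this at [x1] and at [x2] gives semilinear maps into [V' / <h e1>] and
    [V' / <h e2>].  Modulo the span [N12] of [h e1] and [h e2] they induce
    the same projective map, of rank at least two, so that they agree there up
    to one scalar ([additive_rigidity]).  The two vectors [h e1] and [h e2] are
    independent because the morphism separates [x1] and [x2]; hence [V'] is the
    fibre product of the two quotients over [V' / N12], and the two maps glue to
    a semilinear [Phi] from [V] to [V'] ([glue_centers]).

    By construction [Phi v] and [h v] are proportional in each of the two
    quotients, whence they span the same point of [P'] as soon as [h v] is not in [N12].
    A point [y] of [X] mapped into the line of [N12] is reached from outside:
    choose [c1] and [c2] in the cone whose images are independent modulo [N12];
    the plane [y c1 c2] contains a point [w] of [X] other than [y] and off the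
    line [c1 c2].  Then [y] lies in the span of [w], [c1], [c2], all three
    correctly mapped by [Phi], and [<Phi y>] is the only point of the
    span of their images which lies in [N12] ([reconstruction]).

    For uniqueness, two semilinear maps that restrict to the morphism are
    proportional modulo [<h e1>] and modulo [<h e2>] by the same rigidity, and
    the two factors coincide modulo [N12] ([reconstruction_unique]). *)

(** * Spans of two and three vectors over a division ring *)

(* The name [vline] of the vector space library denotes the line as a subspace
   of a finite-dimensional space. *)
Local Notation vline := Defs.vline.

Section Spans.
Variables (K : unitRingType) (V : lmodType K).
Implicit Types (x y z u v w : V) (a b c : K).

Definition span2 x y : set V := [set w | exists a b, w = a *: x + b *: y].

Definition span3 x y z : set V :=
  [set w | exists a b c, w = a *: x + b *: y + c *: z].

Definition free2 x y := forall a b, a *: x + b *: y = 0 -> a = 0 /\ b = 0.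

Definition free3 x y z :=
  forall a b c, a *: x + b *: y + c *: z = 0 -> [/\ a = 0, b = 0 & c = 0].

(** Both vectors may vanish: this is the equality of the values of a partial
    projective map, zero standing for an undefined value. *)
Definition sameline u v := exists2 c : K, c != 0 & u = c *: v.

Lemma vsubspace0 (W : set V) : vsubspace W -> W 0.
Proof. by case/vsubspaceP. Qed.

Lemma vsubspaceD (W : set V) u v : vsubspace W -> W u -> W v -> W (u + v).
Proof. by case/vsubspaceP=> _ Wl Wu Wv; rewrite -[u]scale1r; apply: Wl. Qed.

Lemma vsubspaceN (W : set V) u : vsubspace W -> W u -> W (- u).
Proof. by move=> sW Wu; rewrite -scaleN1r; apply: vsubspaceZ. Qed.

Lemma vsubspaceB (W : set V) u v : vsubspace W -> W u -> W v -> W (u - v).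
Proof. by move=> sW Wu Wv; apply: vsubspaceD => //; apply: vsubspaceN. Qed.

Lemma vsubspace_span2 x y : vsubspace (span2 x y).
Proof.
apply/vsubspaceP; split; first by exists 0, 0; rewrite !scale0r addr0.
move=> a _ _ [b [c ->]] [d [e ->]]; exists (a * b + d), (a * c + e).
by rewrite scalerDr !scalerDl !scalerA addrACA.
Qed.

Lemma vsubspace_span3 x y z : vsubspace (span3 x y z).
Proof.
apply/vsubspaceP; split; first by exists 0, 0, 0; rewrite !scale0r !addr0.
move=> a _ _ [b [c [d ->]]] [e [i [j ->]]].
exists (a * b + e), (a * c + i), (a * d + j).
rewrite !scalerDr !scalerDl !scalerA.
by rewrite [LHS]addrACA [X in X + _]addrACA.
Qed.

Lemma span2l x y : span2 x y x.
Proof. by exists 1, 0; rewrite scale1r scale0r addr0. Qed.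

Lemma span2r x y : span2 x y y.
Proof. by exists 0, 1; rewrite scale1r scale0r add0r. Qed.

Lemma span3_1 x y z : span3 x y z x.
Proof. by exists 1, 0, 0; rewrite scale1r !scale0r !addr0. Qed.

Lemma span3_2 x y z : span3 x y z y.
Proof. by exists 0, 1, 0; rewrite scale1r !scale0r addr0 add0r. Qed.

Lemma span3_3 x y z : span3 x y z z.
Proof. by exists 0, 0, 1; rewrite scale1r !scale0r !add0r. Qed.

Lemma span2_min (W : set V) x y :
  vsubspace W -> W x -> W y -> span2 x y `<=` W.
Proof.
move=> sW Wx Wy _ [a [b ->]]; apply: vsubspaceD => //; exact: vsubspaceZ.
Qed.

Lemma span3_min (W : set V) x y z :
  vsubspace W -> W x -> W y -> W z -> span3 x y z `<=` W.
Proof.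
move=> sW Wx Wy Wz _ [a [b [c ->]]]; apply: vsubspaceD => //.
  by apply: vsubspaceD => //; apply: vsubspaceZ.
exact: vsubspaceZ.
Qed.

Lemma span2C x y : span2 x y = span2 y x.
Proof.
by apply/seteqP; split; apply: span2_min;
  (exact: vsubspace_span2 || exact: span2l || exact: span2r).
Qed.

Lemma free2C x y : free2 x y -> free2 y x.
Proof. by move=> xy a b; rewrite addrC => /xy[]. Qed.

Lemma free3C x y z : free3 x y z -> free3 y x z.
Proof. by move=> xyz a b c; rewrite [a *: _ + _]addrC => /xyz[]. Qed.

Lemma free3R x y z : free3 x y z -> free3 y z x.
Proof. by move=> xyz a b c; rewrite addrC addrA => /xyz[]. Qed.

Lemma free3_12 x y z : free3 x y z -> free2 x y.
Proof.
move=> xyz a b ab; have [] // := xyz a b 0.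
by rewrite scale0r addr0.
Qed.

Lemma free3_23 x y z : free3 x y z -> free2 y z.
Proof. by move=> /free3R/free3_12. Qed.

Lemma free3_13 x y z : free3 x y z -> free2 x z.
Proof. by move=> /free3C/free3_23. Qed.

Lemma free2_n0 x y : free2 x y -> x != 0.
Proof.
move=> xy; apply/eqP => x0.
have [|/eqP] := xy 1 0; first by rewrite x0 scaler0 scale0r addr0.
by rewrite oner_eq0.
Qed.

Lemma free2_inj x y a b c d : free2 x y ->
  a *: x + b *: y = c *: x + d *: y -> a = c /\ b = d.
Proof.
move=> xy /eqP; rewrite -subr_eq0 opprD addrACA -!scalerBl => /eqP/xy[].
by move=> /eqP; rewrite subr_eq0 => /eqP-> /eqP; rewrite subr_eq0 => /eqP->.
Qed.

Lemma free3_inj x y z a b c a' b' c' : free3 x y z ->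
  a *: x + b *: y + c *: z = a' *: x + b' *: y + c' *: z ->
  [/\ a = a', b = b' & c = c'].
Proof.
move=> xyz /eqP; rewrite -subr_eq0 opprD addrACA opprD.
rewrite [X in X + _]addrACA -!scalerBl => /eqP/xyz[].
by move=> /eqP; rewrite subr_eq0 => /eqP-> /eqP; rewrite subr_eq0 => /eqP->
  /eqP; rewrite subr_eq0 => /eqP->.
Qed.

Lemma free2_line x y : free2 x y -> ~ vline y x.
Proof.
move=> xy [a _ ayx]; have [|/eqP] := xy 1 (- a); last by rewrite oner_eq0.
by rewrite scale1r scaleNr ayx subrr.
Qed.

Lemma free3_span2 x y z : free3 x y z -> ~ span2 x y z.
Proof.
move=> xyz [a [b zE]]; have [|_ _ /eqP] := xyz a b (-1).
  by rewrite -zE scaleN1r subrr.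
by rewrite oppr_eq0 oner_eq0.
Qed.

Lemma sameline_refl u : sameline u u.
Proof. by exists 1; rewrite ?oner_neq0// scale1r. Qed.

Lemma sameline_vline u v : sameline u v -> vline v u.
Proof. by case=> c _ ->; exists c. Qed.

Section Division.
Hypothesis divK : division_ring K.

Lemma scaler_eq0_div a v : a *: v = 0 -> v != 0 -> a = 0.
Proof.
move=> av v0; apply/eqP; apply: contraNT v0 => a0.
by rewrite -[v]scale1r -(mulVr (divK a0)) -scalerA av scaler0.
Qed.

Lemma scaler_inj_div a b v : a *: v = b *: v -> v != 0 -> a = b.
Proof.
move=> /eqP; rewrite -subr_eq0 -scalerBl => /eqP /scaler_eq0_div h /h /eqP.
by rewrite subr_eq0 => /eqP.
Qed.

Lemma mulr_neq0_div a b : a != 0 -> b != 0 -> a * b != 0.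
Proof.
move=> a0 b0; apply: contraNneq b0 => ab.
by rewrite -[b]mul1r -(mulVr (divK a0)) -mulrA ab mulr0.
Qed.

Lemma invr_neq0_div a : a != 0 -> a^-1 != 0.
Proof.
move=> a0; apply/eqP => i0; have := mulVr (divK a0).
by move/eqP; rewrite i0 mul0r eq_sym oner_eq0.
Qed.

Lemma sameline_sym u v : sameline u v -> sameline v u.
Proof.
case=> c c0 ->; exists c^-1; first exact: invr_neq0_div.
by rewrite scalerA mulVr ?scale1r//; apply: divK.
Qed.

Lemma sameline_trans v u w : sameline u v -> sameline v w -> sameline u w.
Proof.
by case=> c c0 -> [d d0 ->]; exists (c * d); rewrite ?scalerA// mulr_neq0_div.
Qed.

Lemma sameline_eq0 u v : sameline u v -> (u == 0) = (v == 0).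
Proof.
move=> [c c0 ->]; apply/eqP/eqP => [|->]; last by rewrite scaler0.
move=> cv; apply/eqP/contraT => /(scaler_eq0_div cv)/eqP.
by rewrite (negPf c0).
Qed.

Lemma sameline_sub W u v : vsubspace W -> sameline u v -> W v -> W u.
Proof. by move=> sW [c _ ->]; apply: vsubspaceZ. Qed.

Lemma vline_sameline u v : u != 0 -> vline v u -> sameline u v.
Proof.
move=> u0 [a _ avu]; exists a => //.
by apply: contraNneq u0 => a0; rewrite -avu a0 scale0r.
Qed.

Lemma vlines_sameline u v : vline v u -> vline u v -> sameline u v.
Proof.
have [-> _ [a _ <-]|u0 vu _] := eqVneq u 0.
  by exists 1; rewrite ?oner_neq0// !scaler0.
exact: vline_sameline.
Qed.

Lemma free2P x y : x != 0 -> ~ vline x y -> free2 x y.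
Proof.
move=> x0 nxy a b abE.
have b0 : b = 0.
  apply/eqP/contraT => b0; case: nxy.
  apply: (vsubspaceZK divK (vsubspace_line x) b0).
  by rewrite -(addr0_eq abE); exists (- a); rewrite // scaleNr.
by split=> //; move: abE; rewrite b0 scale0r addr0 => /scaler_eq0_div; apply.
Qed.

Lemma free3P x y z : free2 x y -> ~ span2 x y z -> free3 x y z.
Proof.
move=> xy nz a b c abcE.
have c0 : c = 0.
  apply/eqP/contraT => c0; case: nz.
  apply: (vsubspaceZK divK (vsubspace_span2 x y) c0).
  rewrite -(addr0_eq abcE).
  by apply: vsubspaceN; [apply: vsubspace_span2|exists a, b].
by move: abcE; rewrite c0 scale0r addr0 => /xy[-> ->].
Qed.

Lemma vline_or_free2 x y : x != 0 -> vline x y \/ free2 x y.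
Proof. by move=> x0; have [|/(free2P x0)] := pselect (vline x y); tauto. Qed.

Lemma free2_sameline x y x' y' :
  sameline x x' -> sameline y y' -> free2 x y -> free2 x' y'.
Proof.
move=> xx yy xy; have [x0 y0] := (free2_n0 xy, free2_n0 (free2C xy)).
apply: free2P; first by rewrite -(sameline_eq0 xx).
move=> x'y'; apply: (free2_line (free2C xy)).
apply: (sameline_sub (vsubspace_line _) yy).
case: x'y' => a _ <-; apply: vsubspaceZ; first exact: vsubspace_line.
by apply: sameline_vline; apply: sameline_sym.
Qed.

Lemma free3_sameline x y z x' y' z' : sameline x x' -> sameline y y' ->
  sameline z z' -> free3 x y z -> free3 x' y' z'.
Proof.
move=> xx yy zz xyz a b c.
case: (sameline_sym xx) => d d0 ->; case: (sameline_sym yy) => e e0 ->.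
case: (sameline_sym zz) => m m0 ->; rewrite !scalerA => /xyz[ad be cm].
have nz (t u : K) : u != 0 -> t * u = 0 -> t = 0.
  move=> u0 tu; apply/eqP/contraT => /mulr_neq0_div/(_ u0).
  by rewrite tu eqxx.
by split; [apply: nz d0 ad|apply: nz e0 be|apply: nz m0 cm].
Qed.

Lemma span2_sameline x y x' y' : sameline x x' -> sameline y y' ->
  span2 x y `<=` span2 x' y'.
Proof.
move=> xx yy; apply: span2_min; first exact: vsubspace_span2.
  by apply: (sameline_sub (vsubspace_span2 _ _) xx); apply: span2l.
by apply: (sameline_sub (vsubspace_span2 _ _) yy); apply: span2r.
Qed.

(** Steinitz exchange of one vector. *)
Lemma span2_exchange x y u : u != 0 -> span2 x y u ->
  exists z, span2 x y `<=` span2 u z.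
Proof.
move=> u0 [a [b uE]]; have sS := @vsubspace_span2.
have [a0|a0] := eqVneq a 0.
  exists x; apply: span2_min => //; first exact: span2r.
  have b0 : b != 0.
    by apply: contraNneq u0 => b0; rewrite uE a0 b0 !scale0r addr0.
  apply: (vsubspaceZK divK (sS _ _) b0).
  by move: uE; rewrite a0 scale0r add0r => <-; apply: span2l.
exists y; apply: span2_min => //; last exact: span2r.
apply: (vsubspaceZK divK (sS _ _) a0).
have -> : a *: x = u - b *: y by rewrite uE addrK.
apply: vsubspaceB => //; first exact: span2l.
by apply: vsubspaceZ => //; exact: span2r.
Qed.

Lemma free3_not_span2 x y u v w : free3 u v w ->
  ~ [/\ span2 x y u, span2 x y v & span2 x y w].
Proof.
move=> uvw [Su Sv Sw]; have uv := free3_12 uvw.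
have [z xyz] := span2_exchange (free2_n0 uv) Su.
apply: (free3_span2 uvw).
have [a [b vE]] := xyz _ Sv; have sS := @vsubspace_span2.
apply: (span2_min (sS u v) (span2l u v) _ (xyz _ Sw)).
have b0 : b != 0.
  apply/eqP => b0; apply: (free2_line (free2C uv)).
  by rewrite vE b0 scale0r addr0; exists a.
apply: (vsubspaceZK divK (sS _ _) b0).
have -> : b *: z = v - a *: u by rewrite vE addrAC subrr add0r.
apply: vsubspaceB => //; first exact: span2r.
by apply: vsubspaceZ => //; exact: span2l.
Qed.

End Division.
End Spans.

(** * The fundamental theorem of projective geometry for partial maps *)

Section Fundamental.
Variables (K K' : unitRingType) (divK' : division_ring K').
Variables (V : lmodType K) (W : lmodType K') (g : V -> W).
(* [g] is a choice of representatives for a partial map between projective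
   spaces that sends collinear points to collinear points; where the map is
   undefined, [g] vanishes. *)
Hypothesis gP : forall a b u v, span2 (g u) (g v) (g (a *: u + b *: v)).

Let sS := @vsubspace_span2.

Lemma collin_add u v : span2 (g u) (g v) (g (u + v)).
Proof. by have := gP 1 1 u v; rewrite !scale1r. Qed.

Lemma collin_addl u v : span2 (g (u + v)) (g v) (g u).
Proof. by have := gP 1 (-1) (u + v) v; rewrite scale1r scaleN1r addrK. Qed.

Lemma collin_scale a u : vline (g u) (g (a *: u)).
Proof.
have := gP a 0 u u; rewrite scale0r addr0.
by apply: span2_min; [apply: vsubspace_line|apply: vline_id..].
Qed.

(** If [g e] and [g x] are independent, [g (e + x)] has two nonzero coordinates
    on them, since each of [e] and [x] is a combination of [e + x] and the
    other; so [g x] can be rescaled to make the lift additive on the pair [e],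
    [x]. *)
Lemma lift_exists e E x : sameline E (g e) -> free2 E (g x) ->
  exists2 X, sameline X (g x) & sameline (E + X) (g (e + x)).
Proof.
move=> Ee Ex.
have [a [b gE]] := span2_sameline (sameline_sym divK' Ee) (sameline_refl _)
  (collin_add e x).
have a0 : a != 0.
  apply/eqP => a0; apply: (free2_line Ex).
  apply: (sameline_sub (vsubspace_line _) Ee).
  apply: (span2_min (vsubspace_line _) _ _ (collin_addl e x));
    last exact: vline_id.
  by rewrite gE a0 scale0r add0r; exists b.
have b0 : b != 0.
  apply/eqP => b0; apply: (free2_line (free2C Ex)).
  apply: (span2_min (vsubspace_line _) _ _ (collin_addl x e));
    rewrite 1?[x + e]addrC.
    by rewrite gE b0 scale0r addr0; exists a.
  exact: (sameline_vline (sameline_sym divK' Ee)).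
have i0 := invr_neq0_div divK' a0.
exists (a^-1 *: (b *: g x)).
  by exists (a^-1 * b); rewrite ?scalerA// mulr_neq0_div.
exists a^-1 => //; rewrite gE scalerDr; congr (_ + _).
by rewrite scalerA mulVr ?scale1r//; apply: divK'.
Qed.

Lemma lift_unique (E X X' G H : W) : free2 E H -> sameline X H ->
  sameline X' H -> sameline (E + X) G -> sameline (E + X') G -> X = X'.
Proof.
move=> EH XH X'H EG /(sameline_sym divK') /(sameline_trans divK' EG)[c _ E1].
have EX' := free2_sameline divK' (sameline_refl E) (sameline_sym divK' X'H) EH.
have [d _ XE] := sameline_trans divK' XH (sameline_sym divK' X'H).
have [|c1 dc] := @free2_inj _ _ E X' 1 d c c EX'.
  by rewrite scale1r -XE E1 scalerDr.
by rewrite XE dc -c1 scale1r.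
Qed.

(** The planar step: in the plane spanned by [A], [X], [Y] the image of
    [a + x + y] lies on two lines, whence its coordinates; projecting it from
    [A] onto the line [X Y] gives the image of [x + y]. *)
Lemma lift_triangle a A x X y Y : free3 A X Y ->
  sameline A (g a) -> sameline X (g x) -> sameline Y (g y) ->
  sameline (A + X) (g (a + x)) -> sameline (A + Y) (g (a + y)) ->
  sameline (X + Y) (g (x + y)) /\
  sameline (A + (X + Y)) (g (a + (x + y))).
Proof.
move=> AXY Aa Xx Yy AX AY; have sym := @sameline_sym _ W divK'.
have XY := free3_23 AXY.
have [al gE] : exists al, g (a + (x + y)) = al *: (A + (X + Y)).
  have := collin_add (a + x) y; rewrite -addrA.
  case/(span2_sameline (sym _ _ AX) (sym _ _ Yy)) => al [be gE].
  have := collin_add (a + y) x; rewrite -addrA [y + x]addrC.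
  case/(span2_sameline (sym _ _ AY) (sym _ _ Xx)) => ga [de gE'].
  exists al; move: gE'; rewrite gE !scalerDr [_ + de *: X]addrAC.
  by case/(free3_inj AXY) => -> _ ->; rewrite addrA.
have al0 : al != 0.
  apply/eqP => al0; move: gE; rewrite al0 scale0r => g0.
  have := collin_addl (a + x) y; rewrite -addrA g0.
  case/(span2_sameline (sameline_refl _) (sym _ _ Yy)) => c [d].
  rewrite scaler0 add0r => gax; case: AX => m m0 /eqP.
  rewrite gax scalerA -subr_eq0 -scaleNr -[A]scale1r -[X]scale1r => /eqP/AXY[].
  by move=> /eqP; rewrite oner_eq0.
have G : sameline (A + (X + Y)) (g (a + (x + y))) by apply: sym; exists al.
split=> //.
case: (span2_sameline (sym _ _ Xx) (sym _ _ Yy) (collin_add x y)) => be [ga hE].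
have := collin_addl (x + y) a; rewrite [_ + a]addrC.
case/(span2_sameline (sym _ _ G) (sym _ _ Aa)) => de [ep hE'].
have bg : be = ga.
  move: hE'; rewrite hE !scalerDr addrAC -scalerDl addrA.
  by rewrite -{1}[be *: X]add0r -{1}(scale0r A) => /(free3_inj AXY)[_ -> ->].
move: hE; rewrite -bg -scalerDr => hE; apply: (sym _ _); exists be => //.
apply/eqP => be0; move: hE; rewrite be0 scale0r => h0.
have := collin_addl x y; rewrite h0.
case/(span2_sameline (sameline_refl _) (sym _ _ Yy)) => c [d].
rewrite scaler0 add0r => gx; apply: (free2_line XY).
by apply: (sameline_sub (vsubspace_line _) Xx); rewrite gx; exists d.
Qed.

(** Reference vectors with compatible lifts.  The last condition is how rank at
    least three is used: any independent pair is completed by a reference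
    vector to an independent triple. *)
Definition frame (F : set (V * W)) : Prop :=
  [/\ forall p, F p -> sameline p.2 (g p.1),
      forall p q, F p -> F q -> p = q \/
        free2 p.2 q.2 /\ sameline (p.2 + q.2) (g (p.1 + q.1))
    & forall X Y, exists2 p, F p & ~ span2 X Y p.2].

Definition normalized (F : set (V * W)) x X : Prop :=
  sameline X (g x) /\
  forall p, F p -> free2 p.2 X -> sameline (p.2 + X) (g (p.1 + x)).

Lemma frame_free2 F X : frame F -> X != 0 -> exists2 p, F p & free2 p.2 X.
Proof.
move=> [_ _ F3] X0; have [p Fp nXp] := F3 X 0; exists p => //.
apply: free2C; apply: free2P => // -[a _ aX]; apply: nXp.
by exists a, 0; rewrite aX scale0r addr0.
Qed.

Lemma frame_free3 F X Y : frame F -> free2 X Y ->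
  exists2 p, F p & free3 p.2 X Y.
Proof.
move=> [_ _ F3] XY; have [p Fp nXp] := F3 X Y; exists p => //.
exact: free3R (free3R (free3P divK' XY nXp)).
Qed.

(** If [X] lies in the plane of the two reference vectors, pass through a third
    one outside that plane. *)
Lemma frame_transfer F p q x X : frame F -> F p -> F q ->
  free2 p.2 X -> free2 q.2 X -> sameline X (g x) ->
  sameline (p.2 + X) (g (p.1 + x)) -> sameline (q.2 + X) (g (q.1 + x)).
Proof.
move=> frF Fp Fq pX qX Xx pXx; have [F1 F2 F3] := frF.
case: (F2 p q Fp Fq) => [<-//|[pq pq1]].
have step r s : F r -> F s -> free3 r.2 s.2 X ->
    sameline (r.2 + X) (g (r.1 + x)) -> sameline (s.2 + X) (g (s.1 + x)).
  move=> Fr Fs rsX rX; have [rs|[_ rs1]] := F2 r s Fr Fs.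
    by case: (free2_line (free3_12 rsX)); rewrite rs; apply: vline_id.
  by have [] := lift_triangle rsX (F1 _ Fr) (F1 _ Fs) Xx rs1 rX.
have [Spq|nSpq] := pselect (span2 p.2 q.2 X); last first.
  by apply: step pXx => //; apply: free3P.
have [t Ft nt] := F3 p.2 q.2.
have free r : F r -> free2 r.2 X -> span2 p.2 q.2 r.2 -> free3 r.2 X t.2.
  move=> Fr rX Sr; apply: free3P => // St; apply: nt.
  exact: (span2_min (sS _ _) Sr Spq St).
have pt := free p Fp pX (span2l _ _); have qt := free q Fq qX (span2r _ _).
apply: (step t q Ft Fq); first exact: free3R (free3R qt).
exact: (step p t Fp Ft (free3R (free3C pt)) pXx).
Qed.

Lemma normalized_exists F x : frame F -> exists X, normalized F x X.
Proof.
move=> frF; have [F1 F2 F3] := frF; have [gx0|gx0] := eqVneq (g x) 0.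
  exists 0; split; first by rewrite gx0; apply: sameline_refl.
  by move=> p _ /free2C/free2_n0; rewrite eqxx.
have [p Fp px] := frame_free2 frF gx0.
have [X Xx pX] := lift_exists (F1 p Fp) px.
exists X; split=> // q Fq qX; apply: (frame_transfer frF Fp Fq _ qX Xx pX).
exact: (free2_sameline divK' (sameline_refl _) (sameline_sym divK' Xx) px).
Qed.

(** Where the lifts of [x] and [y] are independent, this is [lift_triangle] seen
    from a reference vector outside their span.  If one of them vanishes, [g]
    does not change along it. *)
Lemma normalized_add F (Phi : V -> W) : frame F ->
  (forall x, normalized F x (Phi x)) -> forall x y, Phi (x + y) = Phi x + Phi y.
Proof.
move=> frF PhiF; have [F1 F2 F3] := frF.
have P1 x : sameline (Phi x) (g x) by case: (PhiF x).
have P1' x : sameline (g x) (Phi x) by apply: (sameline_sym divK').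
have uniq p x Y : F p -> free2 p.2 Y -> sameline Y (g x) ->
    sameline (p.2 + Y) (g (p.1 + x)) -> Phi x = Y.
  move=> Fp pY Yx pYx; have [_ /(_ p Fp) H] := PhiF x.
  have pgx := free2_sameline divK' (sameline_refl _) Yx pY.
  have pPx := free2_sameline divK' (sameline_refl _) (P1' x) pgx.
  exact: lift_unique pgx (P1 x) Yx (H pPx) pYx.
have addf x y : free2 (Phi x) (Phi y) -> Phi (x + y) = Phi x + Phi y.
  move=> xy; have [p Fp pxy] := frame_free3 frF xy.
  have px := free3_12 pxy.
  have py := free3_13 pxy.
  have [s1 s2] := lift_triangle pxy (F1 p Fp) (P1 x) (P1 y)
    ((PhiF x).2 p Fp px) ((PhiF y).2 p Fp py).
  apply: (uniq p) => //; apply: free2P => //; first exact: free2_n0 px.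
  move=> [a _ aE]; have [|/eqP] := pxy (- a) 1 1.
    by rewrite !scale1r -addrA -aE scaleNr addNr.
  by move=> _ /eqP; rewrite oner_eq0.
have gadd0 x z : Phi x = 0 -> sameline (g (x + z)) (g z).
  move=> x0; have gx0 : g x = 0.
    by apply/eqP; rewrite -(sameline_eq0 divK' (P1 x)) x0.
  have vl0 u : vline u (0 : W) by exists 0; rewrite // scale0r.
  apply: vlines_sameline.
    apply: (span2_min (vsubspace_line _) _ _ (collin_add x z));
      last exact: vline_id.
    by rewrite gx0.
  apply: (span2_min (vsubspace_line _) _ _ (collin_addl z x)).
    by rewrite addrC; apply: vline_id.
  by rewrite gx0.
have add0 x y : Phi x = 0 -> Phi (x + y) = Phi y.
  move=> x0; have [y0|y0] := eqVneq (Phi y) 0.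
    apply/eqP; rewrite y0 (sameline_eq0 divK' (P1 _)).
    rewrite (sameline_eq0 divK' (gadd0 _ _ x0)).
    by rewrite -(sameline_eq0 divK' (P1 y)) y0.
  have [p Fp py] := frame_free2 frF y0; apply: (uniq p) => //.
    exact: (sameline_trans divK' (P1 y) (sameline_sym divK' (gadd0 _ _ x0))).
  apply: (sameline_trans divK' ((PhiF y).2 p Fp py)).
  by rewrite addrCA; apply: (sameline_sym divK'); apply: gadd0.
move=> x y; have [x0|x0] := eqVneq (Phi x) 0; first by rewrite add0// x0 add0r.
have [[t _ ty]|] := vline_or_free2 divK' (Phi y) x0; last exact: addf.
have [y0|y0] := eqVneq (Phi y) 0; first by rewrite addrC add0// y0 addr0.
(* The two images are proportional: add an auxiliary vector [z] whose image is
   not, and compare both bracketings of [x + y + z]. *)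
have [p Fp px] := frame_free2 frF x0; set z := p.1.
have zx : free2 (Phi z) (Phi x).
  apply: (free2_sameline divK' _ (sameline_refl _) px).
  exact: (sameline_trans divK' (F1 p Fp) (P1' z)).
have scx (v : W) : v != 0 -> vline (Phi x) v -> free2 v (Phi z).
  move=> v0 /(vline_sameline v0)/(sameline_sym divK') xv.
  by apply: free2C; apply: (free2_sameline divK' (sameline_refl _) xv).
have yz := addf y z (scx _ y0 (ex_intro2 _ _ t I ty)).
have x_yz : Phi (x + (y + z)) = Phi x + (Phi y + Phi z).
  rewrite addf yz// => a b; rewrite -ty scalerDr scalerA addrA -scalerDl => ab.
  have [+ b0] := (free2C zx) _ _ ab.
  by rewrite b0 mul0r addr0.
apply: (@addIr _ (Phi z)); rewrite -[RHS]addrA -x_yz.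
rewrite addrA; have [xy0|xy0] := eqVneq (Phi (x + y)) 0.
  by rewrite xy0 add0r add0.
rewrite [RHS]addf//; apply: scx => //.
apply: (sameline_sub (vsubspace_line _) (P1 _)).
have := span2_sameline (P1' x) (P1' y) (collin_add x y).
apply: span2_min; [exact: vsubspace_line|exact: vline_id|by exists t].
Qed.

(** The lifts of [g v] and [g w] adapted to [g u] are adapted to each other by
    [lift_triangle], which makes the three vectors a frame; the normalized lift
    of every [g x] is then additive. *)
Theorem fundamental_additive u v w : free3 (g u) (g v) (g w) ->
  exists Phi : V -> W, {morph Phi : x y / x + y} /\
    forall x, sameline (Phi x) (g x).
Proof.
move=> uvw; have uv := free3_12 uvw.
have uw := free3_13 uvw.
have [v' v'v uv'] := lift_exists (sameline_refl (g u)) uv.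
have [w' w'w uw'] := lift_exists (sameline_refl (g u)) uw.
have sym := @sameline_sym _ W divK'; have refl := @sameline_refl _ W.
have free' : free3 (g u) v' w'.
  apply: free3P => //.
    exact: (free2_sameline divK' (refl _) (sym _ _ v'v)).
  move=> Sw'; apply: (free3_span2 uvw).
  apply: (sameline_sub (sS _ _) (sym _ _ w'w)).
  exact: (span2_sameline (refl _) v'v Sw').
have [vw' _] := lift_triangle free' (refl _) v'v w'w uv' uw'.
have fuv' := free3_12 free'.
have fvw' := free3_23 free'; have fuw' := free3_13 free'.
pose F : set (V * W) := [set p | [\/ p = (u, g u), p = (v, v') | p = (w, w')]].
have frF : frame F.
  split=> [p [] -> //=|p q|X Y].
    move=> [] -> [] -> /=; try (by left); right; split=> //; try exact: free2C.
    - by rewrite addrC [v + u]addrC.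
    - by rewrite addrC [w + u]addrC.
    - by rewrite addrC [w + v]addrC.
  apply: contrapT => nF; apply: (free3_not_span2 divK' free' (x := X) (y := Y)).
  by split; apply: contrapT => nX; apply: nF;
    [exists (u, g u)|exists (v, v')|exists (w, w')] => //;
    [apply: Or31|apply: Or32|apply: Or33].
have [Phi PhiF] := choice (fun x => normalized_exists x frF).
by exists Phi; split; [apply: normalized_add PhiF|move=> x; case: (PhiF x)].
Qed.

End Fundamental.

Section Additive.
Variables (K K' : unitRingType) (divK' : division_ring K').
Variables (V : lmodType K) (W : lmodType K').
Implicit Types Phi Psi : V -> W.

(** The factor by which [a] acts on the image of a vector is the same for two
    vectors with independent images, as seen on their sum; any two vectors with
    nonzero images are compared through [x] and [y]. *)
Lemma semilinear_of_lines Phi x y : {morph Phi : u v / u + v} ->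
  (forall a v, vline (Phi v) (Phi (a *: v))) -> free2 (Phi x) (Phi y) ->
  Defs.semilinear Phi.
Proof.
move=> addPhi linePhi xy.
have s_ex (q : K * V) : exists c : K', Phi (q.1 *: q.2) = c *: Phi q.2.
  by have [c _ <-] := linePhi q.1 q.2; exists c.
have [s sE] := choice s_ex.
have s_free a u v : free2 (Phi u) (Phi v) -> s (a, u) = s (a, v).
  move=> uv; have := sE (a, u + v).
  rewrite /= scalerDr !addPhi (sE (a, u)) (sE (a, v)) scalerDr.
  by case/(free2_inj uv) => -> ->.
have [x0 y0] := (free2_n0 xy, free2_n0 (free2C xy)).
pose sigma a := s (a, x).
have sigmaE a v : Phi (a *: v) = sigma a *: Phi v.
  rewrite (sE (a, v)) /=; have [->|v0] := eqVneq (Phi v) 0.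
    by rewrite !scaler0.
  have [xv|/s_free <-//] := vline_or_free2 divK' (Phi v) x0.
  have [yv|/s_free <-] := vline_or_free2 divK' (Phi v) y0.
    case: (free2_line xy); apply: (sameline_sub (vsubspace_line _)).
      exact: (sameline_sym divK' (vline_sameline v0 xv)).
    exact: yv.
  by rewrite /sigma (s_free a x y).
have inj a b : a *: Phi x = b *: Phi x -> a = b.
  by move=> /(scaler_inj_div divK'); apply.
have Phi0 : Phi 0 = 0 by apply: (@addrI _ (Phi 0)); rewrite -addPhi !addr0.
have PhiN v : Phi (- v) = - Phi v.
  by apply: (@addIr _ (Phi v)); rewrite -addPhi !addNr.
have sigmaB : {morph sigma : a b / a - b}.
  by move=> a b; apply: inj; rewrite scalerBl -!sigmaE scalerBl addPhi PhiN.
have sigmaM : GRing.monoid_morphism sigma.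
  split; first by apply: inj; rewrite -sigmaE !scale1r.
  by move=> a b; apply: inj; rewrite -scalerA -!sigmaE scalerA.
pose sA := GRing.isZmodMorphism.Build K K' sigma sigmaB.
pose sM := GRing.isMonoidMorphism.Build K K' sigma sigmaM.
pose sigma' : {rmorphism K -> K'} := HB.pack sigma sA sM.
by split=> //; exists sigma'; apply: sigmaE.
Qed.

(** As for the scalars of a semilinear map, the factors at two vectors with
    independent images coincide because of the factor at their sum. *)
Lemma additive_rigidity Phi Psi x y :
  {morph Phi : u v / u + v} -> {morph Psi : u v / u + v} ->
  (forall v, sameline (Phi v) (Psi v)) -> free2 (Psi x) (Psi y) ->
  exists2 c, c != 0 & forall v, Phi v = c *: Psi v.
Proof.
move=> addPhi addPsi PhiPsi xy.
have s_ex v : exists c : K', c != 0 /\ Phi v = c *: Psi v.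
  by have [c c0 cE] := PhiPsi v; exists c.
have [s sE] := choice s_ex.
have s_free u v : free2 (Psi u) (Psi v) -> s u = s v.
  move=> uv; have [_] := sE (u + v).
  rewrite addPhi addPsi (sE u).2 (sE v).2 scalerDr.
  by case/(free2_inj uv) => -> ->.
have [x0 y0] := (free2_n0 xy, free2_n0 (free2C xy)).
exists (s x) => [|v]; first by case: (sE x).
rewrite (sE v).2; have [->|v0] := eqVneq (Psi v) 0; first by rewrite !scaler0.
have [xv|/s_free <-//] := vline_or_free2 divK' (Psi v) x0.
have [yv|/s_free <-] := vline_or_free2 divK' (Psi v) y0.
  case: (free2_line xy); apply: (sameline_sub (vsubspace_line _)).
    exact: (sameline_sym divK' (vline_sameline v0 xv)).
  exact: yv.
by rewrite (s_free x y).
Qed.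

End Additive.

(** * Quotients of modules *)

Section Quotient.
Variables (K : unitRingType) (M : lmodType K) (N : set M) (sN : vsubspace N).

(** The module [M / N] as the type of the cosets of [N]; the proof that [N] is a
    subspace is a parameter of the type so that it carries the module
    structure. *)
Definition vquotient of vsubspace N : Type :=
  {S : set M | exists v, S = [set u | N (u - v)]}.
Local Notation Q := (vquotient sN).

HB.instance Definition _ := gen_eqMixin Q.
HB.instance Definition _ := gen_choiceMixin Q.

Definition vproj (v : M) : Q := exist _ _ (ex_intro _ v erefl).

Definition vrepr (p : Q) : M := projT1 (cid (proj2_sig p)).

Lemma vreprK p : vproj (vrepr p) = p.
Proof.
by rewrite /vrepr; case: p => S Sv; case: cid => v /= SE; apply: eq_exist.
Qed.

Lemma vproj_eq u v : vproj u = vproj v <-> N (u - v).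
Proof.
split=> [/(congr1 sval) /= /seteqP[+ _]|Nuv].
  by apply; rewrite /= subrr; case/vsubspaceP: sN.
apply: eq_exist; apply/seteqP; split=> w /= Nw.
  by rewrite -[w](subrK u) -addrA; apply: vsubspaceD.
by rewrite -[w](subrK v) -addrA; apply: vsubspaceD => //; rewrite -opprB;
  apply: vsubspaceN.
Qed.

(* The operations are locked, lest a sum of classes be unified with the class
   of a sum of representatives. *)
Definition vquot_add (p q : Q) : Q := locked vproj (vrepr p + vrepr q).
Definition vquot_opp (p : Q) : Q := locked vproj (- vrepr p).
Definition vquot_scale (a : K) (p : Q) : Q := locked vproj (a *: vrepr p).

Lemma vrepr_proj v : N (vrepr (vproj v) - v).
Proof. by apply/vproj_eq; rewrite vreprK. Qed.

Lemma vproj_add u v : vproj (u + v) = vquot_add (vproj u) (vproj v).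
Proof.
rewrite /vquot_add -lock; apply/esym/vproj_eq; rewrite opprD addrACA.
by apply: vsubspaceD => //; apply: vrepr_proj.
Qed.

Lemma vproj_opp v : vproj (- v) = vquot_opp (vproj v).
Proof.
rewrite /vquot_opp -lock; apply/esym/vproj_eq; rewrite -opprD.
by apply: vsubspaceN => //; apply: vrepr_proj.
Qed.

Lemma vproj_scale a v : vproj (a *: v) = vquot_scale a (vproj v).
Proof.
rewrite /vquot_scale -lock; apply/esym/vproj_eq; rewrite -scalerBr.
by apply: vsubspaceZ => //; apply: vrepr_proj.
Qed.

Lemma vquot_addA : associative vquot_add.
Proof.
move=> p q r; rewrite -(vreprK p) -(vreprK q) -(vreprK r).
by rewrite -!vproj_add addrA.
Qed.

Lemma vquot_addC : commutative vquot_add.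
Proof. by move=> p q; rewrite /vquot_add addrC. Qed.

Lemma vquot_add0 : left_id (vproj 0) vquot_add.
Proof. by move=> p; rewrite -(vreprK p) -vproj_add add0r. Qed.

Lemma vquot_addN : left_inverse (vproj 0) vquot_opp vquot_add.
Proof. by move=> p; rewrite -(vreprK p) -vproj_opp -vproj_add addNr. Qed.

HB.instance Definition _ :=
  GRing.isZmodule.Build Q vquot_addA vquot_addC vquot_add0 vquot_addN.

Lemma vprojD u v : vproj (u + v) = vproj u + vproj v.
Proof. exact: vproj_add. Qed.

Lemma vquot_scaleA a b p :
  vquot_scale a (vquot_scale b p) = vquot_scale (a * b) p.
Proof. by rewrite -(vreprK p) -!vproj_scale scalerA. Qed.

Lemma vquot_scale1 : left_id 1 vquot_scale.
Proof. by move=> p; rewrite -(vreprK p) -vproj_scale scale1r. Qed.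

Lemma vquot_scaleDr : right_distributive vquot_scale +%R.
Proof.
move=> a p q; rewrite -(vreprK p) -(vreprK q) -vprojD -!vproj_scale -vprojD.
by rewrite scalerDr.
Qed.

Lemma vquot_scaleDl p : {morph vquot_scale^~ p : a b / a + b}.
Proof.
by move=> a b; rewrite -(vreprK p) -!vproj_scale -vprojD scalerDl.
Qed.

HB.instance Definition _ := GRing.Zmodule_isLmodule.Build K Q
  vquot_scaleA vquot_scale1 vquot_scaleDr vquot_scaleDl.

Lemma vprojZ a v : vproj (a *: v) = a *: vproj v.
Proof. exact: vproj_scale. Qed.

Lemma vproj_eq0 v : vproj v = 0 <-> N v.
Proof. by rewrite -{2}[v]subr0 -vproj_eq. Qed.

Lemma vproj_sameline u v : sameline u v -> sameline (vproj u) (vproj v).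
Proof. by case=> a a0 ->; exists a; rewrite ?vprojZ. Qed.

End Quotient.

Section QuotientTower.
Variables (K : unitRingType) (divK : division_ring K) (M : lmodType K).
Variables (N N' : set M) (sN : vsubspace N) (sN' : vsubspace N').
Hypothesis NN' : N `<=` N'.

Definition vreduce (p : vquotient sN) : vquotient sN' := vproj sN' (vrepr p).

Lemma vreduce_proj v : vreduce (vproj sN v) = vproj sN' v.
Proof. by apply/vproj_eq; apply: NN'; apply: vrepr_proj. Qed.

Lemma vreduceD p q : vreduce (p + q) = vreduce p + vreduce q.
Proof. by rewrite -(vreprK p) -(vreprK q) -vprojD !vreduce_proj vprojD. Qed.

Lemma vreduceZ a p : vreduce (a *: p) = a *: vreduce p.
Proof. by rewrite -(vreprK p) -vprojZ !vreduce_proj vprojZ. Qed.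

Lemma vreduce_sameline p q : sameline p q -> sameline (vreduce p) (vreduce q).
Proof. by case=> c c0 ->; exists c => //; apply: vreduceZ. Qed.

Lemma vreduce_free2 p q : free2 (vreduce p) (vreduce q) -> free2 p q.
Proof.
move=> pq a b ab; apply: pq; rewrite -!vreduceZ -vreduceD ab.
by apply/vproj_eq0; rewrite -[vrepr _]subr0; apply: NN'; apply: vrepr_proj.
Qed.

Lemma vproj_free3 q u v : N' q -> ~ N q ->
  free2 (vproj sN' u) (vproj sN' v) ->
  free3 (vproj sN q) (vproj sN u) (vproj sN v).
Proof.
move=> N'q nNq uv a b c; rewrite -!vprojZ -!vprojD => /vproj_eq0 Nabc.
have [] : b = 0 /\ c = 0.
  apply: uv; rewrite -!vprojZ -vprojD; apply/vproj_eq0.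
  have := vsubspaceB sN' (NN' Nabc) (vsubspaceZ a sN' N'q).
  by rewrite -[a *: q + _ + _]addrA addrAC subrr add0r.
move=> b0 c0; split=> //; apply/eqP; apply: contra_notT nNq => a0.
by move: Nabc; rewrite b0 c0 !scale0r !addr0 => /(vsubspaceZK divK sN a0).
Qed.

End QuotientTower.

(** * Projection from a centre *)

Section ConeMaps.
Variables (K K' : unitRingType).
Variables (divK : division_ring K) (divK' : division_ring K').
Variables (V : lmodType K) (V' : lmodType K') (C : set V) (h : V -> V').

Definition preserves_spans := forall w x y z, C w -> C x -> C y -> C z ->
  span3 x y z w -> span3 (h x) (h y) (h z) (h w).

(** [u] and [y] have the same image in the projection from [e]. *)
Definition joined (e u y : V) := span2 e u y /\ span2 e y u.

(** The vector form of [X//x = P//x]: every line through [e] meets the cone [C]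
    again.  The case of [u] proportional to [e] is met by [e] itself. *)
Definition center e := C e /\ forall u, exists2 y, C y & joined e u y.

Hypothesis hP : preserves_spans.

Lemma joined_refl e y : joined e y y.
Proof. by split; apply: span2r. Qed.

Lemma joined_sub e u y (S : set V) : vsubspace S -> joined e u y -> S e ->
  S u <-> S y.
Proof.
by move=> sS [euy eyu] Se; split=> [Su|Sy]; [move: euy|move: eyu];
   apply: span2_min.
Qed.

Lemma vproj_span2 (N : set V') (sN : vsubspace N) p q r s : N p ->
  span3 p q r s -> span2 (vproj sN q) (vproj sN r) (vproj sN s).
Proof.
move=> Np [a [b [c ->]]]; exists b, c; rewrite !vprojD !vprojZ.
by have /(vproj_eq0 sN) -> := Np; rewrite scaler0 add0r.
Qed.

Lemma vproj_line (N : set V') (sN : vsubspace N) p q r s : N p -> N q ->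
  span3 p q r s -> vline (vproj sN r) (vproj sN s).
Proof.
move=> Np Nq /(vproj_span2 sN Np)[a [b ->]]; exists b => //.
by have /(vproj_eq0 sN) -> := Nq; rewrite scaler0 add0r.
Qed.

(** The two centres may differ: modulo a subspace that contains both of their
    images, the projection of a vector of [V] is computed from either. *)
Lemma joined_vproj N (sN : vsubspace N) e e' u y y' : N (h e) -> N (h e') ->
  C e -> C e' -> C y -> C y' -> joined e u y -> joined e' u y' ->
  sameline (vproj sN (h y)) (vproj sN (h y')).
Proof.
move=> Ne Ne' Ce Ce' Cy Cy' uy uy'.
have half d d' z z' : N (h d) -> N (h d') -> C d -> C d' -> C z -> C z' ->
    joined d u z -> joined d' u z' -> vline (vproj sN (h z')) (vproj sN (h z)).
  move=> Nd Nd' Cd Cd' Cz Cz' uz uz'.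
  apply: (vproj_line sN Nd Nd'); apply: hP => //.
  have s3 := @vsubspace_span3 _ _ d d' z'.
  apply/(joined_sub s3 uz); first exact: span3_1.
  by apply/(joined_sub s3 uz'); [exact: span3_2|exact: span3_3].
by apply: vlines_sameline; [apply: (half e e')|apply: (half e' e)].
Qed.

(** Every [u] is joined from [e] to some [Y u] in the cone, and [h (Y u)] modulo
    [h e] respects collinearity: a dependency between the [u]'s becomes one
    between the [Y u]'s and [e]. *)
Lemma center_map N (sN : vsubspace N) e x y z :
  N (h e) -> center e -> C x -> C y -> C z ->
  free3 (vproj sN (h x)) (vproj sN (h y)) (vproj sN (h z)) ->
  exists Phi : V -> vquotient sN, [/\ {morph Phi : u v / u + v},
    (forall a v, vline (Phi v) (Phi (a *: v)))
  & forall v w, C w -> joined e v w -> sameline (Phi v) (vproj sN (h w))].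
Proof.
move=> Ne [Ce cen] Cx Cy Cz xyz.
have cen' u : exists w, C w /\ joined e u w by have [w] := cen u; exists w.
have [Y YP] := choice cen'; pose g u := vproj sN (h (Y u)).
have gP a b u v : span2 (g u) (g v) (g (a *: u + b *: v)).
  apply: (vproj_span2 sN Ne).
  have [[CYu uY] [CYv vY]] := (YP u, YP v).
  have [CY Yuv] := YP (a *: u + b *: v).
  apply: hP => //; have s3 := @vsubspace_span3 _ _ e (Y u) (Y v).
  apply/(joined_sub s3 Yuv); first exact: span3_1.
  apply: vsubspaceD => //; apply: vsubspaceZ => //.
    by apply/(joined_sub s3 uY); [exact: span3_1|exact: span3_2].
  by apply/(joined_sub s3 vY); [exact: span3_1|exact: span3_3].
have gE v w : C w -> joined e v w -> sameline (g v) (vproj sN (h w)).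
  move=> Cw vw; have [CY vY] := YP v.
  exact: (joined_vproj sN Ne Ne Ce Ce CY Cw vY vw).
have gEC w : C w -> sameline (vproj sN (h w)) (g w).
  by move=> Cw; apply: (sameline_sym divK'); apply: gE => //; apply: joined_refl.
have gxyz : free3 (g x) (g y) (g z).
  exact: (free3_sameline divK' (gEC x Cx) (gEC y Cy) (gEC z Cz)).
have [Phi [addPhi PhiE]] := fundamental_additive divK' gP gxyz.
exists Phi; split=> // [a v|v w Cw vw].
  have [c _ cE] := collin_scale gP a v.
  have [d _ PE] := PhiE (a *: v); have [m _ gvE] := sameline_sym divK' (PhiE v).
  by exists (d * (c * m)) => //; rewrite PE -cE gvE !scalerA mulrA.
exact: (sameline_trans divK' (PhiE v) (gE v w Cw vw)).
Qed.

End ConeMaps.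

(** * Gluing the projections from two centres *)

Section Reconstruction.
Variables (K K' : unitRingType).
Variables (divK : division_ring K) (divK' : division_ring K').
Variables (V : lmodType K) (V' : lmodType K') (C : set V) (h : V -> V').
Hypothesis h_neq0 : forall v, C v -> h v != 0.
Variables (e1 e2 : V).
Hypothesis cen1 : center C e1.
Hypothesis cen2 : center C e2.
Hypothesis he12 : free2 (h e1) (h e2).

Let N1 : set V' := vline (h e1).
Let N2 : set V' := vline (h e2).
Let N12 : set V' := span2 (h e1) (h e2).
Let sN1 : vsubspace N1 := vsubspace_line (h e1).
Let sN2 : vsubspace N2 := vsubspace_line (h e2).
Let sN12 : vsubspace N12 := vsubspace_span2 (h e1) (h e2).

Variables (c1 c2 : V).
Hypothesis Cc1 : C c1.
Hypothesis Cc2 : C c2.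
Hypothesis c12 : free2 (vproj sN12 (h c1)) (vproj sN12 (h c2)).

Let N1he1 : N1 (h e1) := vline_id (h e1).
Let N2he2 : N2 (h e2) := vline_id (h e2).
Let N12he1 : N12 (h e1) := span2l (h e1) (h e2).
Let N12he2 : N12 (h e2) := span2r (h e1) (h e2).

Lemma N1N12 : N1 `<=` N12.
Proof. by apply/(vline_sub (h e1) sN12). Qed.

Lemma N2N12 : N2 `<=` N12.
Proof. by apply/(vline_sub (h e2) sN12). Qed.

Lemma N1N2_disjoint v : N1 v -> N2 v -> v = 0.
Proof.
move=> [a _ <-] [b _ /eqP]; rewrite eq_sym -subr_eq0 -scaleNr => /eqP/he12[-> _].
by rewrite scale0r.
Qed.

Lemma vproj12_inj u v :
  vproj sN1 u = vproj sN1 v -> vproj sN2 u = vproj sN2 v -> u = v.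
Proof.
move=> /vproj_eq uv1 /vproj_eq uv2; apply/eqP; rewrite -subr_eq0.
by apply/eqP; apply: N1N2_disjoint.
Qed.

Lemma vproj12_pullback (p : vquotient sN1) (q : vquotient sN2) :
  vreduce sN12 p = vreduce sN12 q ->
  exists v, vproj sN1 v = p /\ vproj sN2 v = q.
Proof.
rewrite -(vreprK p) -(vreprK q) !vreduce_proj; [|exact: N2N12|exact: N1N12].
move=> /vproj_eq[a [b E]]; exists (vrepr p - a *: h e1); split; apply/vproj_eq.
  rewrite addrAC subrr add0r; apply: vsubspaceN => //; exact: vsubspaceZ.
rewrite addrAC E addrAC subrr add0r; exact: vsubspaceZ.
Qed.

(** Both quotients by a centre carry a semilinear map, and the two agree modulo
    the line of the images of the centres up to a scalar; their fibre product is
    [V'] itself. *)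
Lemma glue_centers (hP : preserves_spans C h) :
  exists2 Phi : V -> V', Defs.semilinear Phi &
    forall v, C v ->
      sameline (vproj sN1 (Phi v)) (vproj sN1 (h v)) /\
      sameline (vproj sN2 (Phi v)) (vproj sN2 (h v)).
Proof.
have [[Ce1 cen1'] [Ce2 cen2']] := (cen1, cen2).
have free1 : free3 (vproj sN1 (h e2)) (vproj sN1 (h c1)) (vproj sN1 (h c2)).
  exact: (vproj_free3 divK' N1N12 N12he2 (free2_line (free2C he12)) c12).
have free1' : free3 (vproj sN2 (h e1)) (vproj sN2 (h c1)) (vproj sN2 (h c2)).
  exact: (vproj_free3 divK' N2N12 N12he1 (free2_line he12) c12).
have [F1 [addF1 lineF1 F1P]] :=
  center_map divK' hP (sN := sN1) N1he1 cen1 Ce2 Cc1 Cc2 free1.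
have [F2 [addF2 lineF2 F2P]] :=
  center_map divK' hP (sN := sN2) N2he2 cen2 Ce1 Cc1 Cc2 free1'.
pose G1 v : vquotient sN12 := vreduce sN12 (F1 v).
pose G2 v : vquotient sN12 := vreduce sN12 (F2 v).
have G1P v w : C w -> joined e1 v w -> sameline (G1 v) (vproj sN12 (h w)).
  move=> Cw vw; rewrite -(vreduce_proj sN1 sN12 N1N12).
  exact: (vreduce_sameline sN12 N1N12 (F1P _ _ Cw vw)).
have G2P v w : C w -> joined e2 v w -> sameline (G2 v) (vproj sN12 (h w)).
  move=> Cw vw; rewrite -(vreduce_proj sN2 sN12 N2N12).
  exact: (vreduce_sameline sN12 N2N12 (F2P _ _ Cw vw)).
have G12 v : sameline (G1 v) (G2 v).
  have [[y1 Cy1 vy1] [y2 Cy2 vy2]] := (cen1' v, cen2' v).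
  apply: (sameline_trans divK' (G1P _ _ Cy1 vy1)).
  apply: (sameline_trans divK' _ (sameline_sym divK' (G2P _ _ Cy2 vy2))).
  exact: (joined_vproj hP sN12 N12he1 N12he2 Ce1 Ce2 Cy1 Cy2 vy1 vy2).
have G1c : free2 (G1 c1) (G1 c2).
  by apply: (free2_sameline divK' _ _ c12); apply: (sameline_sym divK');
    apply: G1P => //; apply: joined_refl.
have G2c : free2 (G2 c1) (G2 c2).
  exact: (free2_sameline divK' (G12 c1) (G12 c2) G1c).
have [t t0 G12E] : exists2 t, t != 0 & forall v, G1 v = t *: G2 v.
  by apply: (additive_rigidity divK' _ _ G12 G2c) => u v;
    rewrite /G1 /G2 (addF1, addF2) vreduceD//; [apply: N1N12|apply: N2N12].
pose F2' v := t *: F2 v.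
have G2E v : vreduce sN12 (F1 v) = vreduce sN12 (F2' v).
  by rewrite (vreduceZ _ N2N12); apply: G12E.
have [Phi PhiP] := choice (fun v => vproj12_pullback (G2E v)).
have [Phi1 Phi2] : (forall v, vproj sN1 (Phi v) = F1 v) /\
                   (forall v, vproj sN2 (Phi v) = F2' v).
  by split=> v; case: (PhiP v).
have addF2' : {morph F2' : u v / u + v}.
  by move=> u v; rewrite /F2' addF2 scalerDr.
have lineF2' a v : vline (F2' v) (F2' (a *: v)).
  case: (lineF2 a v) => b _ bE; exists (t * b * t^-1) => //.
  by rewrite /F2' -bE !scalerA -!mulrA mulVr ?mulr1//; apply: divK'.
have freeF1 : free2 (F1 c1) (F1 c2) by exact: vreduce_free2 N1N12 _ _ G1c.
have freeF2' : free2 (F2' c1) (F2' c2).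
  by apply: (@vreduce_free2 _ _ _ _ sN2 sN12 N2N12); rewrite -!G2E.
have [_ [sigma sigmaE]] := semilinear_of_lines divK' addF1 lineF1 freeF1.
have [_ [tau tauE]] := semilinear_of_lines divK' addF2' lineF2' freeF2'.
have sigma_tau a : sigma a = tau a.
  apply: (scaler_inj_div divK' _ (free2_n0 G1c)).
  rewrite -(vreduceZ _ N1N12) -sigmaE G2E tauE (vreduceZ _ N2N12) -G2E //.
exists Phi; first split.
- move=> u v; apply: vproj12_inj; rewrite vprojD.
    by rewrite !Phi1 addF1.
  by rewrite !Phi2 addF2'.
- exists sigma => a v; apply: vproj12_inj; rewrite vprojZ.
    by rewrite !Phi1 sigmaE.
  by rewrite !Phi2 tauE sigma_tau.
move=> v Cv; rewrite Phi1 Phi2; split; first exact: F1P (joined_refl _ _).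
have [d d0 dE] := F2P v v Cv (joined_refl _ _).
by exists (t * d); rewrite ?mulr_neq0_div// /F2' dE scalerA.
Qed.

(** What is used of the existence of enough points: a plane through [x], [y],
    [z] has a fourth point which is off the line [y z]. *)
Definition plane_points := forall x y z, C x -> C y -> C z -> free3 x y z ->
  exists w, [/\ C w, span3 x y z w, ~ span2 y z w & ~ vline x w].

Lemma semilinear_neq0 (sigma : {rmorphism K -> K'}) a : a != 0 -> sigma a != 0.
Proof.
move=> a0; have : sigma a \is a GRing.unit by apply: rmorph_unit; apply: divK.
by apply: contraTneq => ->; rewrite unitr0.
Qed.

Lemma semilinear0 (Phi : V -> V') : Defs.semilinear Phi -> Phi 0 = 0.
Proof. by case=> _ [s sE]; rewrite -(scale0r 0) sE rmorph0 scale0r. Qed.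

(** The glued map represents [h] off [N12]; a vector of the cone mapped into
    [N12] is reached through a plane with three points mapped outside. *)
Theorem reconstruction (hP : preserves_spans C h) (hE : plane_points) :
  exists2 Phi : V -> V', Defs.semilinear Phi &
    forall v, C v -> sameline (Phi v) (h v).
Proof.
have [Phi sPhi PhiP] := glue_centers hP; exists Phi => //.
have [addPhi [sigma sigmaE]] := sPhi.
have Phi_neq0 v : C v -> Phi v != 0.
  move=> Cv; have [s1 s2] := PhiP v Cv; apply: contra_neq (h_neq0 Cv) => P0.
  have z N (sN : vsubspace N) : vproj sN 0 = 0.
    by apply/vproj_eq0; apply: vsubspace0.
  move: (sameline_eq0 divK' s1) (sameline_eq0 divK' s2).
  rewrite P0 !z !eqxx => /esym/eqP/(vproj_eq0 sN1) n1.
  move=> /esym/eqP/(vproj_eq0 sN2) n2.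
  exact: N1N2_disjoint.
have congr1 v : C v -> exists2 a, a != 0 & N1 (Phi v - a *: h v).
  move=> Cv; have [[a a0 +] _] := PhiP v Cv; rewrite -vprojZ => /vproj_eq ?.
  by exists a.
have congr2 v : C v -> exists2 a, a != 0 & N2 (Phi v - a *: h v).
  move=> Cv; have [_ [a a0 +]] := PhiP v Cv; rewrite -vprojZ => /vproj_eq ?.
  by exists a.
have off v : C v -> ~ N12 (h v) -> sameline (Phi v) (h v).
  move=> Cv nv; have [[a a0 Na] [b b0 Nb]] := (congr1 v Cv, congr2 v Cv).
  suff ab : a = b.
    by exists a => //; apply/eqP; rewrite -subr_eq0; apply/eqP;
      apply: N1N2_disjoint => //; rewrite ab.
  apply/eqP; apply: contra_notT nv; rewrite -subr_eq0.
  move=> /(vsubspaceZK divK' sN12); apply; rewrite scalerBl.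
  have := vsubspaceB sN12 (N2N12 Nb) (N1N12 Na).
  by rewrite opprB [_ - _ + _]addrC addrA subrK.
have on v : C v -> N12 (h v) -> N12 (Phi v).
  move=> Cv Nv; have [a _ Na] := congr1 v Cv.
  rewrite -[Phi v](subrK (a *: h v)); apply: vsubspaceD => //.
    exact: N1N12.
  exact: vsubspaceZ.
move=> y Cy; have [Ny|] := pselect (N12 (h y)); last exact: off.
have nc1 : ~ N12 (h c1).
  by move=> /(vproj_eq0 sN12)/eqP; apply/negP; exact: free2_n0 c12.
have nc2 : ~ N12 (h c2).
  by move=> /(vproj_eq0 sN12)/eqP; apply/negP; exact: free2_n0 (free2C c12).
have [s1 s2] := (off _ Cc1 nc1, off _ Cc2 nc2).
have Pc12 : free2 (vproj sN12 (Phi c1)) (vproj sN12 (Phi c2)).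
  by apply: (free2_sameline divK' _ _ c12); apply: (sameline_sym divK');
    apply: vproj_sameline.
have PhiE a b d : Phi (a *: y + b *: c1 + d *: c2) =
    sigma a *: Phi y + sigma b *: Phi c1 + sigma d *: Phi c2.
  by rewrite !addPhi !sigmaE.
have NPhi a b d : N12 (a *: Phi y + b *: Phi c1 + d *: Phi c2) ->
    b = 0 /\ d = 0.
  move=> /(vproj_eq0 sN12); rewrite !vprojD !vprojZ.
  have /(vproj_eq0 sN12) -> := on y Cy Ny.
  by rewrite scaler0 add0r => /Pc12.
have sigma_inj a : sigma a = 0 -> a = 0.
  by move=> /eqP sa; apply/eqP; apply: contraTT sa => /semilinear_neq0.
have yc : free3 y c1 c2.
  move=> a b d abd; have := PhiE a b d.
  rewrite abd (semilinear0 sPhi) => /esym abd'.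
  have [|/sigma_inj b0 /sigma_inj d0] := NPhi (sigma a) (sigma b) (sigma d).
    by rewrite abd'; apply: vsubspace0.
  split=> //; apply: sigma_inj; apply: (scaler_eq0_div divK' _ (Phi_neq0 y Cy)).
  by move: abd'; rewrite b0 d0 rmorph0 !scale0r !addr0.
(* The vector [y] is a combination of [w], [c1], [c2], whose images [Phi]
   represents; a combination of [Phi y], [Phi c1], [Phi c2] that lies in [N12]
   is a multiple of [Phi y]. *)
have [w [Cw [a [b [d wE]]] nw nyw]] := hE _ _ _ Cy Cc1 Cc2 yc.
have a0 : a != 0.
  by apply: contra_notN nw => /eqP a0; exists b, d; rewrite wE a0 scale0r add0r.
have nPw : ~ N12 (Phi w).
  rewrite wE PhiE => /NPhi[/sigma_inj b0 /sigma_inj d0]; apply: nyw.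
  by exists a => //; rewrite wE b0 d0 !scale0r !addr0.
have sw : sameline (Phi w) (h w) by apply: off => // /(on w Cw).
have Sy : span3 w c1 c2 y.
  have sS := vsubspace_span3 w c1 c2.
  apply: (vsubspaceZK divK sS a0).
  have -> : a *: y = w - b *: c1 - d *: c2.
    by rewrite wE [RHS]addrAC !addrK.
  apply: vsubspaceB => //; last by apply: vsubspaceZ => //; apply: span3_3.
  apply: vsubspaceB => //; first exact: span3_1.
  by apply: vsubspaceZ => //; apply: span3_2.
have sS := vsubspace_span3 (Phi y) (Phi c1) (Phi c2).
have sub v : sameline (Phi v) (h v) ->
    span3 (Phi y) (Phi c1) (Phi c2) (Phi v) ->
    span3 (Phi y) (Phi c1) (Phi c2) (h v).
  by move=> /(sameline_sym divK')/(sameline_sub sS).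
have [m [n [k hyE]]] : span3 (Phi y) (Phi c1) (Phi c2) (h y).
  apply: (span3_min sS _ _ _ (hP _ _ _ _ Cy Cw Cc1 Cc2 Sy)).
  - apply: sub => //; rewrite wE PhiE.
    by exists (sigma a), (sigma b), (sigma d).
  - by apply: sub => //; apply: span3_2.
  - by apply: sub => //; apply: span3_3.
apply: (sameline_sym divK'); apply: vline_sameline; first exact: h_neq0.
move: Ny; rewrite hyE => /NPhi[-> ->]; exists m => //.
by rewrite !scale0r !addr0.
Qed.

(** Both maps induce the same projection from each centre, so they are
    proportional in both quotients, by factors that coincide modulo [N12]. *)
Theorem reconstruction_unique (Phi Psi : V -> V') :
  Defs.semilinear Phi -> Defs.semilinear Psi ->
  (forall v, C v -> sameline (Phi v) (h v)) ->
  (forall v, C v -> sameline (Psi v) (h v)) ->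
  exists2 c, c != 0 & forall v, Phi v = c *: Psi v.
Proof.
move=> sPhi sPsi PhiP PsiP.
have PP v : C v -> sameline (Phi v) (Psi v).
  move=> Cv; apply: (sameline_trans divK' (PhiP v Cv)).
  exact: (sameline_sym divK' (PsiP v Cv)).
have [addPhi [sigma sigmaE]] := sPhi; have [addPsi [tau tauE]] := sPsi.
have c12Psi : free2 (vproj sN12 (Psi c1)) (vproj sN12 (Psi c2)).
  by apply: (free2_sameline divK' _ _ c12); apply: (sameline_sym divK');
    apply: vproj_sameline; apply: PsiP.
have rigid N (sN : vsubspace N) e : N `<=` N12 -> N (h e) -> center C e ->
    exists2 c, c != 0 & forall v, vproj sN (Phi v) = c *: vproj sN (Psi v).
  move=> NN12 Ne [Ce cen]; apply: (additive_rigidity divK') => [u v|u v|v|].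
  - by rewrite addPhi vprojD.
  - by rewrite addPsi vprojD.
  - have [y Cy [_ [a [b vE]]]] := cen v.
    have /(vproj_eq0 sN) Phie := sameline_sub sN (PhiP e Ce) Ne.
    have /(vproj_eq0 sN) Psie := sameline_sub sN (PsiP e Ce) Ne.
    rewrite vE addPhi addPsi !sigmaE !tauE !vprojD !vprojZ Phie Psie.
    rewrite !scaler0 !add0r; have [->|b0] := eqVneq b 0.
      by rewrite !rmorph0 !scale0r; apply: sameline_refl.
    have [m m0 ->] := vproj_sameline sN (PP y Cy).
    have tb := semilinear_neq0 tau b0; have sb := semilinear_neq0 sigma b0.
    exists (sigma b * m * (tau b)^-1).
      by rewrite !mulr_neq0_div// invr_neq0_div.
    by rewrite !scalerA -!mulrA mulVr ?mulr1//; apply: divK'.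
  apply: (vreduce_free2 (sN' := sN12) NN12).
  by rewrite !vreduce_proj//; exact: c12Psi.
have [a a0 aE] := rigid N1 sN1 e1 N1N12 N1he1 cen1.
have [b b0 bE] := rigid N2 sN2 e2 N2N12 N2he2 cen2.
have ab : a = b.
  apply: (scaler_inj_div divK' _ (free2_n0 c12Psi)).
  rewrite -{1}(vreduce_proj sN1 sN12 N1N12) -(vreduceZ _ N1N12) -aE.
  rewrite -(vreduce_proj sN2 sN12 N2N12 (Psi c1)) -(vreduceZ _ N2N12) -bE.
  by rewrite !vreduce_proj//; [apply: N2N12|apply: N1N12].
exists a => // v; apply: vproj12_inj; rewrite vprojZ ?aE//.
by rewrite ab bE.
Qed.

End Reconstruction.

(** * Planes of a geometry and vectors over a projective space *)

Section PlanesAndLines.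
Variable G : geometry.
Implicit Types (x y z : G) (A B S : set G).

Lemma gclosure_id A x : A x -> gclosure A x.
Proof. by move=> Ax; apply: sub_gen_smallest. Qed.

Lemma gclosure_min A S : is_subspace S -> A `<=` S -> gclosure A `<=` S.
Proof. by move=> sS AS; apply: smallest_sub. Qed.

Lemma gclosure_mono A B : A `<=` B -> gclosure A `<=` gclosure B.
Proof.
move=> AB; apply: gclosure_min; first exact: closure_subspace.
by move=> x /AB; apply: gclosure_id.
Qed.

(** Independence is tested on an enumeration so that cardinals are immediate. *)
Lemma has_dim_closure n (p : nat -> G) :
  (forall i, (i <= n)%N ->
    ~ gclosure [set p j | j in [set j | (j <= n)%N && (j != i)]] (p i)) ->
  has_dim (gclosure [set p j | j in `I_n.+1]) n.
Proof.
move=> free_p; split; first exact: closure_subspace.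
exists [set p j | j in `I_n.+1].
  split=> // [x|_ [i /= ilt <-]]; first exact: gclosure_id.
  move/(gclosure_mono _); apply: contra_not (free_p i ilt); apply.
  move=> _ [[j jlt <-] ji]; exists j => //=; apply/andP; split; first exact: jlt.
  by apply/eqP => ij; apply: ji; rewrite ij.
apply: inj_card_eq => i j /set_mem/= ilt /set_mem/= jlt pij.
apply/eqP/contraT => ij; case: (free_p i ilt); apply: gclosure_id.
by exists j => //=; rewrite eq_sym ij andbT.
Qed.

Lemma line_closure x y : x <> y -> is_line (gclosure [set x; y]).
Proof.
move=> xy; pose p i := if i is 0 then x else y.
have -> : [set x; y] = [set p j | j in `I_2].
  apply/seteqP; split=> [z [->|->]|_ [[|[|//]] _ <-]];
    [by exists 0|by exists 1|by left|by right].
have single i z A : A `<=` [set z] -> p i <> z -> ~ gclosure A (p i).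
  by move=> Az piz /(gclosure_min (subspace1 z) Az).
apply: has_dim_closure => -[|[|//]] _;
  [apply: (single _ y)|apply: (single _ x)] => //.
- by move=> _ [[|[|//]] //= _ <-].
- by move=> _ [[|[|//]] //= _ <-].
- by move=> /esym.
Qed.

Lemma plane_closure x y z :
  ~ gclosure [set y; z] x -> ~ gclosure [set x; z] y ->
  ~ gclosure [set x; y] z ->
  is_plane (gclosure [set x; y; z]).
Proof.
move=> nx ny nz; pose p i := if i is 0 then x else if i is 1 then y else z.
have -> : [set x; y; z] = [set p j | j in `I_3].
  apply/seteqP; split=> [w [[->|->]|->]|_ [[|[|[|//]]] _ <-]].
  - by exists 0.
  - by exists 1.
  - by exists 2.
  - by left; left.
  - by left; right.
  - by right.
apply: has_dim_closure => -[|[|[|//]]] _.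
- apply: contra_not nx; apply: gclosure_mono.
  by move=> _ [[|[|[|//]]] //= _ <-]; [left|right].
- apply: contra_not ny; apply: gclosure_mono.
  by move=> _ [[|[|[|//]]] //= _ <-]; [left|right].
- apply: contra_not nz; apply: gclosure_mono.
  by move=> _ [[|[|[|//]]] //= _ <-]; [left|right].
Qed.

(** Of four points of a plane, no three on a line, at most two lie on the line
    [y z], and at most one is [x]. *)
Lemma enough_points_off_line x y z : enough_points G ->
  ~ gclosure [set y; z] x -> ~ gclosure [set x; z] y ->
  ~ gclosure [set x; y] z ->
  exists w, [/\ gclosure [set x; y; z] w, ~ gclosure [set y; z] w & w <> x].
Proof.
move=> [_ ep] nx ny nz; have [p [p_inj pS pfree]] := ep _ (plane_closure nx ny nz).
apply: contrapT => nw.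
have pP i : p i = x \/ gclosure [set y; z] (p i).
  have [|pix] := pselect (p i = x); [by left|right].
  by apply: contrapT => npi; apply: nw; exists (p i).
have [i0 i0P] : exists i0, forall i, p i = x -> i = i0.
  have [[i pix]|ni] := pselect (exists i, p i = x).
    by exists i => j pjx; apply: p_inj; rewrite pix pjx.
  by exists ord0 => i pix; case: ni; exists i.
have pl j : gclosure [set y; z] (p (lift i0 j)).
  have [/i0P/esym/eqP|//] := pP (lift i0 j).
  by rewrite (negPf (neq_lift i0 j)).
have yz : y <> z by move=> yz; apply: nz; apply: gclosure_id; right; rewrite yz.
apply: (pfree (lift i0 ord0) (lift i0 1) (lift i0 ord_max)); last first.
  by exists (gclosure [set y; z]); split=> //; apply: line_closure.
by rewrite -[[:: _; _; _]]/(map (lift i0) [:: ord0; 1; ord_max])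
  (map_inj_uniq lift_inj).
Qed.

End PlanesAndLines.

Section Representatives.
Variables (K : unitRingType) (divK : division_ring K) (V : lmodType K).
Local Notation P := (projective_space divK V).

Definition represents v (p : P) := exists v0 : v != 0, p = vline_point v0.

Lemma representsP (p : P) : exists v, represents v p.
Proof. by have [v [v0 ->]] := proj_pointP p; exists v, v0. Qed.

Lemma represents_inj v w p q : represents v p -> represents w q ->
  vline v w -> p = q.
Proof.
move=> [v0 ->] [w0 ->] /(vline_sameline w0) wv; apply: eq_exist.
apply/seteqP; split; apply/vline_sub; try exact: vsubspace_line.
  by apply: sameline_vline; apply: (sameline_sym divK).
exact: sameline_vline.
Qed.

Lemma represents_sameline v w p : represents v p -> represents w p ->
  sameline v w.
Proof.
move=> [v0 ->] [w0 /(congr1 sval)/= vw]; apply: vline_sameline => //.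
by rewrite -vw; apply: vline_id.
Qed.

Lemma sameline_represents v w p : sameline v w -> represents w p ->
  represents v p.
Proof.
move=> vw [w0 pE].
have v0 : v != 0 by rewrite (sameline_eq0 divK vw).
exists v0; apply: (@represents_inj w v); [by exists w0|by exists v0|].
exact: sameline_vline.
Qed.

Lemma proj_of_represents W v p : vsubspace W -> represents v p ->
  proj_of W p <-> W v.
Proof. by move=> sW [v0 ->]; apply: proj_ofE. Qed.

Lemma proj_of_subspace (W : set V) :
  vsubspace W -> is_subspace (proj_of W : set P).
Proof. by move=> sW; exists W. Qed.

Lemma gjoin_span2 v w u p q r : represents v p -> represents w q ->
  represents u r -> gjoin [set p] [set q] r -> span2 v w u.
Proof.
move=> vp wq ur Jr; have sS := vsubspace_span2 v w.
apply/(proj_of_represents sS ur); move: r Jr {ur}; apply: gclosure_min.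
  exact: proj_of_subspace.
by move=> _ [->|->]; [apply/(proj_of_represents sS vp); apply: span2l
                     |apply/(proj_of_represents sS wq); apply: span2r].
Qed.

Variable X : set P.
Implicit Types x y z t : subgeometry X.

Lemma sub_incl_inj x y : sub_incl x = sub_incl y -> x = y.
Proof. exact: set_val_inj. Qed.

Lemma subgeometry_span2 u v w x y z : represents u (sub_incl x) ->
  represents v (sub_incl y) -> represents w (sub_incl z) ->
  gclosure [set x; y] z <-> span2 u v w.
Proof.
move=> ux vy wz; have sS := vsubspace_span2 u v; split.
  move=> cz; apply/(proj_of_represents sS wz).
  apply: (gclosure_min (S := @sub_incl _ X @^-1` proj_of (span2 u v)) _ _ cz).
    by exists (proj_of (span2 u v)) => //; apply: proj_of_subspace.
  by move=> _ [->|->]; [apply/(proj_of_represents sS ux); apply: span2l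
                       |apply/(proj_of_represents sS vy); apply: span2r].
move=> Sw _ [[_ [W sW <-] <-] WP]; apply/(proj_of_represents sW wz).
by apply: (span2_min sW _ _ Sw); [apply/(proj_of_represents sW ux)
  |apply/(proj_of_represents sW vy)]; apply: WP; [left|right].
Qed.

Lemma subgeometry_span3 u v w s x y z t : represents u (sub_incl x) ->
  represents v (sub_incl y) -> represents w (sub_incl z) ->
  represents s (sub_incl t) ->
  gclosure [set x; y; z] t -> span3 u v w s.
Proof.
move=> ux vy wz st ct; have sS := vsubspace_span3 u v w.
apply/(proj_of_represents sS st).
apply: (gclosure_min (S := @sub_incl _ X @^-1` proj_of (span3 u v w)) _ _ ct).
  by exists (proj_of (span3 u v w)) => //; apply: proj_of_subspace.
move=> _ [[->|->]|->].
- by apply/(proj_of_represents sS ux); apply: span3_1.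
- by apply/(proj_of_represents sS vy); apply: span3_2.
- by apply/(proj_of_represents sS wz); apply: span3_3.
Qed.

Definition cone : set V :=
  [set v | exists x : subgeometry X, represents v (sub_incl x)].

Lemma same_quotient_center x e : represents e (sub_incl x) ->
  same_quotient x -> center cone e.
Proof.
move=> ex sqx; split; first by exists x.
move=> u; have [[a _ <-]|neu] := pselect (vline e u).
  exists e; first by exists x.
  split; first exact: span2l.
  by apply: vsubspaceZ; [apply: vsubspace_span2|apply: span2l].
have u0 : u != 0.
  by apply: contra_not_neq neu => ->; apply: vsubspace0; apply: vsubspace_line.
pose p : P := vline_point u0; have up : represents u p by exists u0.
have : gquotient [set sub_incl x] (quotient_class [set sub_incl x] p).
  exists p => //= px; apply: neu; apply/sameline_vline.
  by rewrite px in up; apply: (represents_sameline up ex).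
rewrite -sqx => -[_ [y /= yx <-]]; rewrite quotient_incl_class// => qE.
have : quotient_class [set sub_incl x] p p.
  split=> // px; apply: neu; apply/sameline_vline.
  by rewrite px in up; apply: (represents_sameline up ex).
rewrite -qE => -[_ J].
have [w wy] := representsP (sub_incl y); exists w; first by exists y.
split; rewrite span2C.
  apply: (gjoin_span2 up ex wy); rewrite J; apply: gclosure_id; by left.
apply: (gjoin_span2 wy ex up); rewrite -J; apply: gclosure_id; by left.
Qed.

Lemma cone_plane_points : enough_points (subgeometry X) -> plane_points cone.
Proof.
move=> ep u v w [x ux] [y vy] [z wz] uvw.
have [t [tS tl tx]] : exists t, [/\ gclosure [set x; y; z] t,
    ~ gclosure [set y; z] t & t <> x].
  apply: enough_points_off_line => //.
  - move/(subgeometry_span2 vy wz ux); exact: free3_span2 (free3R uvw).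
  - move/(subgeometry_span2 ux wz vy); rewrite span2C.
    exact: free3_span2 (free3R (free3R uvw)).
  - move/(subgeometry_span2 ux vy wz); exact: free3_span2 uvw.
have [s st] := representsP (sub_incl t).
exists s; split; first by exists t.
- exact: (subgeometry_span3 ux vy wz st).
- by move/(subgeometry_span2 vy wz st).
- by move=> us; apply: tx; apply: sub_incl_inj; apply/esym;
    apply: (represents_inj ux st us).
Qed.

End Representatives.

(** * Lifting the morphism to vectors *)

Section Target.
Variables (K : unitRingType) (divK : division_ring K) (V : lmodType K).
Local Notation P := (projective_space divK V).

(** Three of the independent points given by the dimension cannot lie on one
    line. *)
Lemma dim_ge3_not_span2 (u v : V) : dim_ge [set: P] 3 ->
  exists w, ~ span2 u v w.
Proof.
move=> [_ [A [_ indA _] /card_leP[i]]].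
have mem k : (k < 4)%N -> k \in `I_4 by move=> k4; apply/mem_set.
pose a k (k4 : (k < 4)%N) : P := set_val (i (SigSub (mem k k4))).
have Aa k k4 : A (a k k4) by apply: set_valP.
have a_inj k k4 l l4 : a k k4 = a l l4 -> k = l.
  by move=> /set_val_inj/(@inj _ _ _ i _ _ (mem_set I) (mem_set I)) [].
have [[[u0 a0] [u1 a1]] [u2 a2]] := (representsP (a 0 isT),
  representsP (a 1 isT), representsP (a 2 isT)).
apply: contrapT => nw.
have uv w : span2 u v w by apply: contrapT => nuvw; apply: nw; exists w.
apply: (@free3_not_span2 _ _ divK u v u0 u1 u2); last by split.
apply: free3P => //.
  apply: free2P => //; first by case: a0.
  by move=> /(represents_inj a0 a1)/a_inj.
move=> S; apply: (indA _ (Aa 2 isT)) => _ [[W sW <-] WP].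
apply/(proj_of_represents sW a2); apply: (span2_min sW _ _ S).
  by apply/(proj_of_represents sW a0); apply: WP; split=> // /a_inj.
by apply/(proj_of_represents sW a1); apply: WP; split=> // /a_inj.
Qed.

Lemma span3_plane (u v w : V) : free3 u v w -> exists2 S : set P, is_plane S &
  forall x p, represents x p -> span3 u v w x -> S p.
Proof.
move=> uvw.
have u0 := free2_n0 (free3_12 uvw).
have v0 := free2_n0 (free3_23 uvw).
have w0 := free2_n0 (free3_12 (free3R (free3R uvw))).
pose p : P := vline_point u0; pose q : P := vline_point v0.
pose r : P := vline_point w0.
have [up vq wr] : [/\ represents u p, represents v q & represents w r].
  by split; [exists u0|exists v0|exists w0].
exists (gclosure [set p; q; r]).
  have join x y z (a b c : P) : represents x a -> represents y b ->
      represents z c -> gclosure [set a; b] c -> span2 x y z.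
    by move=> xa yb zc; rewrite /= => ab; apply: (gjoin_span2 xa yb zc).
  apply: plane_closure.
  - by move/(join _ _ _ _ _ _ vq wr up); apply: free3_span2 (free3R uvw).
  - move/(join _ _ _ _ _ _ up wr vq); rewrite span2C.
    exact: free3_span2 (free3R (free3R uvw)).
  - by move/(join _ _ _ _ _ _ up vq wr); apply: free3_span2 uvw.
move=> x s xs Sx _ [[W sW <-] WP]; apply/(proj_of_represents sW xs).
by apply: (span3_min sW _ _ _ Sx);
  [apply/(proj_of_represents sW up)|apply/(proj_of_represents sW vq)
  |apply/(proj_of_represents sW wr)]; apply: WP; [left; left|left; right|right].
Qed.

End Target.

Section MorphismLift.
Variables (K K' : unitRingType).
Variables (divK : division_ring K) (divK' : division_ring K').
Variables (V : lmodType K) (V' : lmodType K').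
Local Notation P := (projective_space divK V).
Local Notation P' := (projective_space divK' V').
Variables (X : set P) (f : subgeometry X -> P').

Definition lifts (h : V -> V') := forall v (x : subgeometry X),
  represents v (sub_incl x) -> represents (h v) (f x).

Lemma lifts_exists : exists h, lifts h.
Proof.
have ex v : exists w, forall x : subgeometry X,
    represents v (sub_incl x) -> represents w (f x).
  have [[x vx]|nv] := pselect (cone X v); last first.
    by exists 0 => x vx; case: nv; exists x.
  have [w wx] := representsP (f x); exists w => y vy.
  have -> // : y = x.
  apply: sub_incl_inj; apply: (represents_inj vy vx); exact: vline_id.
by have [h hP] := choice ex; exists h.
Qed.

Variable h : V -> V'.
Hypothesis hf : lifts h.

Lemma lifts_neq0 v : cone X v -> h v != 0.
Proof. by move=> [x /hf[]]. Qed.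

Lemma morphism_preserves_spans : is_morphism f -> preserves_spans (cone X) h.
Proof.
move=> mf w x y z [pw wp] [px xp] [py yp] [pz zp] Sw.
have sS := vsubspace_span3 (h x) (h y) (h z).
have [_ [W sW <-] WE] := mf _ (proj_of_subspace divK' sS).
have mem (v : V) (p : subgeometry X) : represents v (sub_incl p) ->
    W v <-> span3 (h x) (h y) (h z) (h v).
  move=> vp; split=> [/(proj_of_represents sW vp)|] H.
    apply/(proj_of_represents sS (hf vp)).
    by have : (f @^-1` proj_of (span3 (h x) (h y) (h z))) p by rewrite -WE.
  apply/(proj_of_represents sW vp).
  have : (f @^-1` proj_of (span3 (h x) (h y) (h z))) p.
    exact/(proj_of_represents sS (hf vp)).
  by rewrite -WE.
apply/(mem w pw wp); apply: (span3_min sW _ _ _ Sw).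
- by apply/(mem x px xp); apply: span3_1.
- by apply/(mem y py yp); apply: span3_2.
- by apply/(mem z pz zp); apply: span3_3.
Qed.

Lemma nonplanar_escape (u v w : V') : free3 u v w ->
  ~ (exists2 S : set P', is_plane S & range f `<=` S) ->
  exists2 c, cone X c & ~ span3 u v w (h c).
Proof.
move=> uvw npl; have [S plS SP] := span3_plane divK' uvw.
apply: contrapT => nc; apply: npl; exists S => // _ [x _ <-].
have [c cx] := representsP (sub_incl x); apply: (SP _ _ (hf cx)).
by apply: contrapT => nS; apply: nc; exists c => //; exists x.
Qed.

(** First leave the plane spanned by [u], [v] and any third vector, then the
    plane spanned by [u], [v] and the image just found. *)
Lemma nonplanar_free (u v : V') : dim_ge [set: P'] 3 -> free2 u v ->
  ~ (exists2 S : set P', is_plane S & range f `<=` S) ->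
  exists c1 c2, [/\ cone X c1, cone X c2 &
    free2 (vproj (vsubspace_span2 u v) (h c1))
          (vproj (vsubspace_span2 u v) (h c2))].
Proof.
move=> dimP' uv npl; have sN := vsubspace_span2 u v.
have esc w : ~ span2 u v w -> exists2 c, cone X c & ~ span3 u v w (h c).
  by move=> nw; apply: nonplanar_escape => //; apply: free3P.
have sub w : span2 u v `<=` span3 u v w.
  by apply: span2_min; [apply: vsubspace_span3|apply: span3_1|apply: span3_2].
have [w nw] := dim_ge3_not_span2 u v dimP'.
have [c1 Cc1 nc1] := esc w nw.
have {}nc1 : ~ span2 u v (h c1) by move/(@sub w).
have [c2 Cc2 nc2] := esc (h c1) nc1.
exists c1, c2; split=> //; apply: free2P => //.
  by apply/eqP => /vproj_eq0.
case=> a _; rewrite -vprojZ => /esym/vproj_eq [b [d E]].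
by apply: nc2; exists b, d, a; rewrite -E subrK.
Qed.

Definition induced_map (Phi : V -> V') (phi : P -> option P') :=
  forall (v : V) (v0 : v != 0),
    (Phi v = 0 -> phi (vline_point v0) = None) /\
    forall w0 : Phi v != 0, phi (vline_point v0) = Some (vline_point w0).

Lemma induced_map_exists Phi : Defs.semilinear Phi ->
  exists phi, induced_map Phi phi.
Proof.
move=> [addPhi [s sE]].
have ex (p : P) : exists o : option P', forall v, represents v p ->
    (Phi v = 0 -> o = None) /\ forall q, represents (Phi v) q -> o = Some q.
  have [v vp] := representsP p.
  have same w : represents w p -> sameline (Phi w) (Phi v).
    move=> wp; have [a a0 ->] := represents_sameline wp vp.
    by exists (s a); [apply: semilinear_neq0|apply: sE].
  have [Pv0|Pv0] := eqVneq (Phi v) 0.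
    exists None => w /same wv; split=> // q [w0].
    by case/eqP: w0; apply/eqP; rewrite (sameline_eq0 divK' wv) Pv0.
  exists (Some (vline_point Pv0)) => w /same wv; split=> [w0|q wq].
    by case/eqP: Pv0; apply/eqP; rewrite -(sameline_eq0 divK' wv) w0.
  congr Some; apply: (@represents_inj _ divK' _ (Phi v) (Phi w)) => //.
    by exists Pv0.
  exact: sameline_vline.
have [phi phiP] := choice ex; exists phi => v v0.
have [|n s'] := phiP (vline_point v0) v; first by exists v0.
by split=> // w0; apply: s'; exists w0.
Qed.

Lemma induced_map_lifts Phi phi : induced_map Phi phi ->
  (forall v, cone X v -> sameline (Phi v) (h v)) ->
  forall x : subgeometry X, phi (sub_incl x) = Some (f x).
Proof.
move=> phiP Phih x; have [v vx] := representsP (sub_incl x).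
have [w0 fxE] := sameline_represents (Phih v (ex_intro _ x vx)) (hf vx).
have [v0 ->] := vx; rewrite fxE; exact: (phiP v v0).2.
Qed.

Lemma induced_map_cone Phi phi : induced_map Phi phi ->
  (forall x : subgeometry X, phi (sub_incl x) = Some (f x)) ->
  forall v, cone X v -> sameline (Phi v) (h v).
Proof.
move=> phiP phif v [x vx]; have [v0 xE] := vx; have [n s] := phiP v v0.
have := phif x; rewrite xE; have [/n -> //|w0] := eqVneq (Phi v) 0.
rewrite (s w0) => -[fxE]; apply: (represents_sameline _ (hf vx)).
by rewrite -fxE; exists w0.
Qed.

Lemma induced_map_scale Phi Psi phi psi c : induced_map Phi phi ->
  induced_map Psi psi -> c != 0 -> (forall v, Phi v = c *: Psi v) -> phi = psi.
Proof.
move=> phiP psiP c0 cE; apply: funext => p; have [v [v0 ->]] := proj_pointP p.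
have [n s] := phiP v v0; have [n' s'] := psiP v v0.
have same : sameline (Phi v) (Psi v) by exists c.
have [Pv0|w0] := eqVneq (Psi v) 0; first by rewrite n' ?n// cE Pv0 scaler0.
have w1 : Phi v != 0 by rewrite (sameline_eq0 divK' same).
rewrite (s w1) (s' w0); congr Some.
apply: (@represents_inj _ divK' _ (Phi v) (Psi v)); [by exists w1|by exists w0|].
exact: (sameline_vline (sameline_sym divK' same)).
Qed.

End MorphismLift.

Theorem theorem2p4
  (K K' : unitRingType) (divK : division_ring K) (divK' : division_ring K')
  (V : lmodType K) (V' : lmodType K')
  (dimP : dim_ge [set: projective_space divK V] 3)
  (dimP' : dim_ge [set: projective_space divK' V'] 3)
  (X : set (projective_space divK V))
  (epX : enough_points (subgeometry X))
  (f : subgeometry X -> projective_space divK' V')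
  (mor_f : is_morphism f)
  (f_nonplanar :
    ~ exists2 S : set (projective_space divK' V'), is_plane S & range f `<=` S)
  (quot_f : exists x1 x2 : subgeometry X,
    [/\ same_quotient x1, same_quotient x2 & f x1 <> f x2]) :
  exists! phi : projective_space divK V -> option (projective_space divK' V'),
    partial_projective_morphism phi /\
    forall x : subgeometry X, phi (sub_incl x) = Some (f x).
Proof.
have [h hf] := lifts_exists f; have hP := morphism_preserves_spans hf mor_f.
have [x1 [x2 [sq1 sq2 fx12]]] := quot_f.
have [e1 ex1] := representsP (sub_incl x1).
have [e2 ex2] := representsP (sub_incl x2).
have cen1 := same_quotient_center ex1 sq1.
have cen2 := same_quotient_center ex2 sq2.
have he12 : free2 (h e1) (h e2).
  apply: (free2P divK'); first by case: (hf _ _ ex1).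
  by move=> /(represents_inj (hf _ _ ex1) (hf _ _ ex2)).
have [c1 [c2 [Cc1 Cc2 c12]]] := nonplanar_free hf dimP' he12 f_nonplanar.
have [Phi sPhi PhiP] := reconstruction divK divK' (lifts_neq0 hf) cen1 cen2 he12
  Cc1 Cc2 c12 hP (cone_plane_points epX).
have [phi phiP] := induced_map_exists divK divK' sPhi.
exists phi; split.
  split; first by exists Phi.
  exact (induced_map_lifts hf phiP PhiP).
move=> psi [[Psi sPsi psiP] psif].
have PsiP := induced_map_cone hf psiP psif.
have [c c0 cE] := reconstruction_unique divK divK' cen1 cen2 he12 Cc1 Cc2 c12
  sPhi sPsi PhiP PsiP.
exact: induced_map_scale phiP psiP c0 cE.
Qed.
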